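(* Let $\mu$ be a probability distribution on $\mathbb N=\{0,1,2,\ldots\}$ with $|\mu|_1\le 1$ and $|\mu|_2=\infty$. For $n\in\mathbb N$ such that a Bienaymé tree with offspring distribution $\mu$ has size $n$ with positive probability, let $T_n$ be a Bienaymé tree with offspring distribution $\mu$ conditioned to have size $n$, and let $V_n$ be a uniformly random node of $T_n$. Then, as $n\to\infty$ (along such $n$), $$\frac{\mathrm{wid}(T_n)}{n^{1/2}}\to\infty,\qquad \frac{|V_n|}{n^{1/2}}\to 0,\qquad \frac{\mathrm{ht}(T_n)}{n^{1/2}\log^3 n}\to 0,$$ where each of these convergences holds both in probability and in expectation.
   Context: A plane tree is a finite rooted tree in which the children of each node are ordered from left to right. A Bienaymé tree with offspring distribution $\mu$ is the family tree $T$ of a branching (Galton–Watson) process started from one individual with offspring distribution $\mu$. If $\mathbf P\{T \text{ has } n \text{ vertices}\}>0$, the Bienaymé tree conditioned to have size $n$ is the random plane tree $T_n$ with $\mathbf P\{T_n=t\}=\mathbf P\{T=t\mid T\text{ has } n\text{ vertices}\}$ for every plane tree $t$ with $n$ vertices. For $p>0$, $|\mu|_p=\left(\sum_{c\ge0}c^p\mu(c)\right)^{1/p}$, where $\mu(c)=\mu(\{c\})$. The height $|v|$ of a node $v$ is its graph distance to the root; $\mathrm{ht}(t)=\max_{v}|v|$; $\mathrm{wid}(t)=\max_{k\ge0}|\{v\in t:|v|=k\}|$. For random variables $X_n\ge 0$, ''$X_n\to 0$ (resp. $\infty$) in expectation'' means $\mathbf E[X_n]\to0$ (resp. $\infty$);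 ''$X_n\to\infty$ in probability'' means $\mathbf P\{X_n\ge K\}\to1$ for every $K$. *)

(* Defs.v *)
From HB Require Import structures.
From mathcomp Require Export all_boot all_order all_algebra.
From mathcomp Require Export all_classical all_reals all_analysis.
Export Order.TTheory GRing.Theory Num.Theory.
Export numFieldNormedType.Exports.

Set Implicit Arguments.
Unset Strict Implicit.
Unset Printing Implicit Defensive.

#[export] Set Implicit Arguments.
#[export] Unset Strict Implicit.
#[export] Unset Printing Implicit Defensive.

Local Open Scope classical_set_scope.
Local Open Scope ring_scope.

Inductive plane_tree := Node of seq plane_tree.

(* Nodes are Ulam-Harris words: the root is [::], and the child number i
   (from 0, left to right) of the root of t carries a copy of the words of the
   i-th subtree, prefixed by i. The graph distance from a node to the root is
   the length of its word. *)
Fixpoint nodes (t : plane_tree) : seq (seq nat) :=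
  let: Node ts := t in
  [::] :: flatten [seq [seq iu.1 :: u | u <- iu.2]
                  | iu <- zip (iota 0 (size ts)) [seq nodes t' | t' <- ts]].

Definition tree_size (t : plane_tree) : nat := size (nodes t).

Definition ht (t : plane_tree) : nat := (\max_(u <- nodes t) size u)%N.

(* Levels above the height are empty, so this is the maximum over all k. *)
Definition wid (t : plane_tree) : nat :=
  (\max_(k < (ht t).+1) count (fun u => size u == k) (nodes t))%N.

(* The (possibly infinite) family tree in which the individual u has c u
   children: a word is an individual iff each of its letters is smaller than
   the number of children of the prefix before that letter. *)
Definition family_tree (c : seq nat -> nat) : set (seq nat) :=
  [set u | forall i, (i < size u)%N -> (nth 0 u i < c (take i u))%N].

(* |mu|_p, in [0, +oo] *)
Definition pnorm (R : realType) (mu : probability nat R) (p : R) : \bar R :=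
  ((\sum_(0 <= c <oo) (c%:R `^ p)%:E * mu [set c]) `^ p^-1)%E.

Section Bienayme.
Context (R : realType) (d : measure_display) (Omega : measurableType d).
Variables (P : probability Omega R) (xi : seq nat -> {RV P >-> nat}).

Definition mutually_independent : Prop :=
  forall (s : seq (seq nat)) (A : seq nat -> set nat), uniq s ->
    P [set w | forall u, u \in s -> A u (xi u w)]
    = (\prod_(u <- s) P (xi u @^-1` A u))%E.

(* xi u is the number of children that u has, if u is ever born. *)
Definition branching_process (mu : probability nat R) : Prop :=
  mutually_independent /\
  forall u (A : set nat), distribution P (xi u) A = mu A.

Definition bienayme_is (t : plane_tree) : set Omega :=
  [set w | family_tree (fun u => xi u w) = [set` nodes t]].

Definition bienayme_has_size (n : nat) : set Omega :=
  [set w | exists2 t, tree_size t = n & bienayme_is t w].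

End Bienayme.

Definition cond_prob (R : realType) (d : measure_display)
    (Omega : measurableType d) (P : probability Omega R) (A B : set Omega) : R :=
  fine (P (A `&` B)) / fine (P B).

(* Measurability with respect to the discrete sigma-algebra; used for maps to
   the countable types plane_tree and seq nat. *)
Definition discrete_measurable_fun (d : measure_display)
    (Omega : measurableType d) (U : Type) (X : Omega -> U) : Prop :=
  forall A : set U, measurable (X @^-1` A).

(* T is a random plane tree with the law of the Bienayme tree driven by xi
   conditioned to have size n; meaningful when that size has positive
   probability. *)
Definition conditioned_bienayme (R : realType)
    (d0 : measure_display) (Omega0 : measurableType d0)
    (P0 : probability Omega0 R) (xi : seq nat -> {RV P0 >-> nat}) (n : nat)
    (d : measure_display) (Omega : measurableType d) (P : probability Omega R)
    (T : Omega -> plane_tree) : Prop :=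
  discrete_measurable_fun T /\
  forall t, tree_size t = n ->
    P [set w | T w = t]
    = (cond_prob P0 (bienayme_is xi t) (bienayme_has_size xi n))%:E.

(* Given T = t, where t has n nodes, V is uniform on the nodes of t. *)
Definition uniform_node (R : realType) (n : nat)
    (d : measure_display) (Omega : measurableType d) (P : probability Omega R)
    (T : Omega -> plane_tree) (V : Omega -> seq nat) : Prop :=
  discrete_measurable_fun V /\
  forall t v, tree_size t = n -> v \in nodes t ->
    P [set w | T w = t /\ V w = v] = (P [set w | T w = t] * (n%:R^-1)%:E)%E.

Section Modes.
Context (R : realType) (d : nat -> measure_display).
Context (Omega : forall n, measurableType (d n)).
Variables (P : forall n, probability (Omega n) R) (F : set_system nat).
Variable X : forall n, Omega n -> R.

Definition to0_in_probability : Prop :=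
  forall e : R, 0 < e ->
    P n [set w | e < `|X w|] @[n --> F] --> (0 : \bar R)%E.

Definition to0_in_expectation : Prop :=
  ('E_(P n)[@X n])%E @[n --> F] --> (0 : \bar R)%E.

Definition to_oo_in_probability : Prop :=
  forall K : R, P n [set w | K <= X w] @[n --> F] --> (1 : \bar R)%E.

Definition to_oo_in_expectation : Prop :=
  ('E_(P n)[@X n])%E @[n --> F] --> (+oo : \bar R)%E.

End Modes.

(* Main.v *)
Require Import Defs.
From HB Require Import structures.
From mathcomp Require Import measurable_realfun.
From mathcomp Require Import zify ring lra.

Local Open Scope classical_set_scope.
Local Open Scope ring_scope.

(** Everything rests on an exact formula for the height of a uniform node
    [V_n], obtained by following the path from the root to that node: if
    [c_1, ..., c_n] are independent offspring numbers conditioned to have sum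
    [n - 1], then [P(|V_n| >= k)] is the expectation of [c_1 ... c_k]
    ([sum_nb_above]). Indeed a node of the path with [c] children offers [c] ways
    to go on, and what lies off the path is a forest, whose total weight is given
    by the Otter-Dwass formula ([sum_forest_weight]).

    By the binomial theorem, the mixture of these tails over a binomial index [k]
    with parameters [n] and [u] is the expectation of the product of the
    [1 + u (c_i - 1)]. The tails decrease in [k], so that
    [P(|V_n| >= k)] is at most twice that expectation when [u = k / (2 n)]
    ([spine_sum_le_mix]). Now [1 + x <= exp x], with a gain of a factor
    [exp (- x ^ 2 / 8)] for [0 <= x <= 1 / 2], and the sum of the [c_i - 1] is
    [- 1]; hence the expectation is at most that of [exp (- u ^ 2 S / 8)], where
    [S] sums the squares of the [c_i - 1] over the [c_i] between 2 and a fixed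
    [M]. Without conditioning, [S] is at least a constant times [n] outside an
    event of exponentially small probability, and the constant is as large as
    desired since the second moment is infinite. Conditioning does not spoil
    this, because it costs at most a subexponential factor
    ([convpow_subexponential]): atoms that decay subexponentially, which exist as
    the second moment is infinite, compensate the deviations of the other
    variables at a negligible price. So for every [A] the tail is at most
    [4 exp (- A k ^ 2 / n)] for large [n] and [k] up to a multiple of [n]
    ([spine_sum_tail]).

    Summing over [k] shows that [|V_n|] is [o(sqrt n)] in expectation. A union
    bound over the nodes shows that the height is [O(sqrt n log n)] in
    expectation, which is [o(sqrt n log ^ 3 n)]. Finally a tree of width at most
    [K sqrt n] has mean node height at least a constant times [sqrt n], so that
    it is unlikely by the first assertion. *)

(** * Nodes of plane trees and family trees *)

(** Equality of trees need not be computed: it is only used to enumerate finite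
    sets of trees without repetition. *)
HB.instance Definition _ := gen_eqMixin plane_tree.
HB.instance Definition _ := gen_choiceMixin plane_tree.

Notation leaf := (Node [::]).

Lemma nodesE ts : nodes (Node ts) =
  [::] :: flatten [seq [seq i :: u | u <- nodes (nth leaf ts i)]
                  | i <- iota 0 (size ts)].
Proof.
rewrite /=; congr (_ :: flatten _).
apply: (@eq_from_nth _ [::]) => [|i].
  by rewrite !size_map size_zip !size_map size_iota minnn.
rewrite size_map size_zip !size_map size_iota minnn => lti.
rewrite (nth_map (0, [::])%N) ?size_zip ?size_map ?size_iota ?minnn//.
rewrite (nth_map 0%N) ?size_iota// nth_zip ?size_map ?size_iota// nth_iota//=.
by rewrite (nth_map leaf).
Qed.

Lemma nil_nodes t : [::] \in nodes t.
Proof. by case: t => ts; rewrite nodesE inE eqxx. Qed.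

Lemma cons_nodes ts i u :
  (i :: u \in nodes (Node ts)) =
  (i < size ts)%N && (u \in nodes (nth leaf ts i)).
Proof.
rewrite nodesE inE /=; apply/flatten_mapP/andP.
  by case=> j; rewrite mem_iota => /= ltj /mapP[v vj [-> ->]].
case=> lti ui; exists i; first by rewrite mem_iota.
by apply/mapP; exists u.
Qed.

Lemma big_nodes (S : Type) (idx : S) (op : Monoid.law idx) (F : seq nat -> S)
    ts : \big[op/idx]_(u <- nodes (Node ts)) F u =
  op (F [::]) (\big[op/idx]_(i < size ts)
     \big[op/idx]_(u <- nodes (nth leaf ts i)) F (val i :: u)).
Proof.
rewrite nodesE big_cons big_flatten big_map; congr (op _ _).
rewrite -[X in iota 0 X]subn0 -/(index_iota 0 (size ts)) big_mkord.
by apply: eq_bigr => i _; rewrite big_map.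
Qed.

Lemma plane_tree_induction (Q : plane_tree -> Prop) :
  (forall ts, (forall i, (i < size ts)%N -> Q (nth leaf ts i)) -> Q (Node ts)) ->
  forall t, Q t.
Proof.
move=> QN; fix IH 1 => -[ts]; apply: QN.
elim: ts => [i|t ts IHts [|i]] /=; first by clear IH; rewrite ltn0.
  by move=> _; exact: IH.
exact: IHts.
Qed.

Lemma uniq_flatten_map (I T : eqType) (s : seq I) (F : I -> seq T) :
  uniq s -> {in s, forall i, uniq (F i)} ->
  {in s &, forall i j x, x \in F i -> x \in F j -> i = j} ->
  uniq (flatten [seq F i | i <- s]).
Proof.
elim: s => //= i s IH /andP[iNs us] uF dF; rewrite cat_uniq.
have sub j : j \in s -> j \in i :: s by rewrite inE orbC => ->.
rewrite uF ?mem_head// IH//=; last first.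
- by move=> j k js ks; apply: dF; exact: sub.
- by move=> j js; apply: uF; exact: sub.
rewrite andbT; apply/hasPn => x /flatten_mapP[j js xFj]; apply/negP => xFi.
by move: iNs; rewrite (dF _ _ (mem_head _ _) (sub _ js) x xFi xFj) js.
Qed.

Lemma uniq_nodes t : uniq (nodes t).
Proof.
elim/plane_tree_induction: t => ts IH; rewrite nodesE cons_uniq.
apply/andP; split; first by apply/flatten_mapP => -[i _ /mapP[]].
apply: uniq_flatten_map; first exact: iota_uniq.
  move=> i; rewrite mem_iota => /= lti.
  by rewrite map_inj_uniq ?IH// => u v [].
by move=> i j _ _ x /mapP[u _ ->] /mapP[v _ []].
Qed.

Fixpoint nchild (t : plane_tree) (u : seq nat) {struct u} : nat :=
  let: Node ts := t in
  if u is i :: v then nchild (nth leaf ts i) v else size ts.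

Lemma family_tree_rcons c u i :
  family_tree c (rcons u i) <-> family_tree c u /\ (i < c u)%N.
Proof.
rewrite /family_tree /= size_rcons; split=> [fc|[fc ic] j].
  split=> [j ltj|]; last first.
    have := fc (size u) (ltnSn _).
    by rewrite nth_rcons ltnn eqxx -cats1 take_size_cat.
  have := fc j (ltnW ltj); rewrite nth_rcons ltj -cats1 takel_cat//.
  exact: ltnW.
rewrite ltnS leq_eqVlt nth_rcons -cats1 => /orP[/eqP->|ltj].
  by rewrite ltnn eqxx take_size_cat.
by rewrite ltj takel_cat ?(ltnW ltj)//; apply: fc.
Qed.

Lemma nodes_family_tree t : family_tree (nchild t) = [set` nodes t].
Proof.
apply/seteqP; split=> u /=; elim: u t => [|i u IH] [ts]; rewrite ?nil_nodes//.
  move=> fu; rewrite cons_nodes; apply/andP; split; first exact: (fu 0%N).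
  by apply: IH => j ltj; exact: (fu j.+1).
rewrite cons_nodes => /andP[lti ui] [|j] //= ltj.
exact: IH.
Qed.

Lemma eq_family_tree (c c' : seq nat -> nat) :
  (forall u, family_tree c u -> c u = c' u) -> family_tree c = family_tree c'.
Proof.
move=> cc'; apply/seteqP; split; elim/last_ind => [|u i IH]//.
  move=> /family_tree_rcons[fu ic]; apply/family_tree_rcons.
  by rewrite -cc'//; split=> //; exact: IH.
move=> /family_tree_rcons[/IH fu ic]; apply/family_tree_rcons.
by rewrite cc'.
Qed.

Lemma family_tree_inj c c' u :
  family_tree c = family_tree c' -> family_tree c u -> c u = c' u.
Proof.
move=> cc' fu; have fu' : family_tree c' u by rewrite -cc'.
have lt i : (i < c u <-> i < c' u)%N.
  have := family_tree_rcons c u i; have := family_tree_rcons c' u i.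
  by rewrite cc'; tauto.
have [ltc|gtc|//] := ltngtP (c u) (c' u).
  by have := ltnn (c u); rewrite (proj2 (lt _) ltc).
by have := ltnn (c' u); rewrite (proj1 (lt _) gtc).
Qed.

(** This turns the event that the family tree is [t] into finitely many
    independent constraints, one for each node of [t]. *)
Lemma family_tree_eqP c t :
  family_tree c = [set` nodes t] <-> {in nodes t, c =1 nchild t}.
Proof.
rewrite -nodes_family_tree; split=> [ct u ut|ct].
  by apply: family_tree_inj; rewrite // ct nodes_family_tree.
apply/esym/eq_family_tree => u; rewrite nodes_family_tree => ut.
by rewrite ct.
Qed.

Lemma nodes_inj t t' : [set` nodes t] = [set` nodes t'] -> t = t'.
Proof.
rewrite -!nodes_family_tree => ft.
have {ft} : {in nodes t, nchild t =1 nchild t'}.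
  by move=> u ut; apply: family_tree_inj; rewrite // nodes_family_tree.
elim/plane_tree_induction: t t' => ts IH [ts'] eqc.
have szts := eqc [::] (nil_nodes _); congr Node.
apply: (@eq_from_nth _ leaf) => // i lti; apply: IH => // u ui.
by apply: (eqc (i :: u)); rewrite cons_nodes lti.
Qed.

(** * Plane forests and their weights *)

Definition forest_size (f : seq plane_tree) : nat := sumn (map tree_size f).

Lemma tree_size_Node ts : tree_size (Node ts) = (forest_size ts).+1.
Proof.
rewrite /tree_size /forest_size nodesE /= size_flatten /shape -map_comp.
congr (sumn _).+1; apply: (@eq_from_nth _ 0%N); rewrite !size_map size_iota//.
move=> i lti; rewrite (nth_map 0%N) ?size_iota// (nth_map leaf)//=.
by rewrite size_map nth_iota.
Qed.

(** Removing the root of the first tree of a forest leaves a forest with one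
    node less, in which the children of that root come first. Undoing this
    operation lists all forests of [j] trees with [m] nodes in total. *)
Fixpoint forests (m j : nat) : seq (seq plane_tree) :=
  match m, j with
  | 0%N, 0%N => [:: [::]]
  | m'.+1, j'.+1 =>
      flatten [seq [seq Node (take c g) :: drop c g | g <- forests m' (j' + c)%N]
              | c <- iota 0 m]
  | _, _ => [::]
  end.

Lemma forestsS m j : forests m.+1 j.+1 =
  flatten [seq [seq Node (take c g) :: drop c g | g <- forests m (j + c)%N]
          | c <- iota 0 m.+1].
Proof. by []. Qed.

Lemma mem_forests m j f :
  (f \in forests m j) = (size f == j) && (forest_size f == m).
Proof.
have size0 g : forest_size g = 0%N -> g = [::].
  by case: g => // -[ts] g; rewrite /forest_size /= tree_size_Node.
elim: m j f => [|m IH] [|j] f.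
- rewrite inE; apply/eqP/andP => [->//|[/eqP/size0nil]//].
- rewrite in_nil; apply/esym/negP => -[/andP[szf /eqP/size0 f0]].
  by rewrite f0 in szf.
- by rewrite in_nil; apply/esym/negP => -[/andP[/eqP/size0nil ->]].
rewrite forestsS; apply/flatten_mapP/andP.
  case=> c _ /mapP[g]; rewrite IH => /andP[/eqP szg /eqP fsg ->].
  rewrite /= size_drop szg addnK eqxx; split=> //.
  rewrite /forest_size /= tree_size_Node addSn -fsg /forest_size -sumn_cat.
  by rewrite -map_cat cat_take_drop.
case: f => [|[ts] f] [] //.
move=> /eqP[szf].
rewrite /forest_size /= tree_size_Node addSn eqSS => /eqP fs.
have fs' : forest_size (ts ++ f) = m.
  by rewrite /forest_size map_cat sumn_cat -fs.
have tree_gt0 g : (size g <= forest_size g)%N.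
  elim: g => //= -[us] g; rewrite /forest_size /= tree_size_Node; lia.
exists (size ts).
  rewrite -[_ :: _]/(iota 0 m.+1) mem_iota add0n /= ltnS -fs'.
  by rewrite (leq_trans _ (tree_gt0 _))// size_cat leq_addr.
apply/mapP; exists (ts ++ f); last by rewrite take_size_cat ?drop_size_cat.
by rewrite IH size_cat szf addnC fs' !eqxx.
Qed.

Lemma uniq_forests m j : uniq (forests m j).
Proof.
elim: m j => [|m IH] [|j] //; rewrite forestsS; apply: uniq_flatten_map.
- exact: iota_uniq.
- move=> c _; rewrite map_inj_uniq// => g g' [tg dg].
  by rewrite -(cat_take_drop c g) tg dg cat_take_drop.
move=> c c' _ _ f /mapP[g + ->] /mapP[g' +].
rewrite !mem_forests => /andP[/eqP sg _] /andP[/eqP sg' _] [+ _].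
by move=> /(congr1 size); rewrite !size_takel ?sg ?sg' ?leq_addl.
Qed.

Section Weights.
Context (R : realFieldType) (p : nat -> R).

(** When [p] is the offspring distribution, this is the probability that the
    family tree is [t]. *)
Definition weight (t : plane_tree) : R := \prod_(u <- nodes t) p (nchild t u).

Definition forest_weight (f : seq plane_tree) : R := \prod_(t <- f) weight t.

Lemma weight_Node ts : weight (Node ts) = p (size ts) * forest_weight ts.
Proof.
rewrite /weight big_nodes /=; congr (_ * _).
by rewrite /forest_weight (big_nth leaf) big_mkord.
Qed.

Lemma forest_weight_Node ts f :
  forest_weight (Node ts :: f) = p (size ts) * forest_weight (ts ++ f).
Proof. by rewrite /forest_weight big_cons weight_Node big_cat mulrA. Qed.

Lemma sum_forests_first_root (X : seq plane_tree -> R) m j :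
  \sum_(f <- forests m.+1 j.+1) forest_weight f * X f =
  \sum_(c < m.+1) p c * \sum_(g <- forests m (j + c))
     forest_weight g * X (Node (take c g) :: drop c g).
Proof.
rewrite forestsS -[iota 0 _]/(index_iota 0 m.+1) big_flatten big_map.
rewrite big_mkord; apply: eq_bigr => c _; rewrite big_map big_distrr /=.
rewrite big_seq [RHS]big_seq; apply: eq_bigr => g.
rewrite mem_forests => /andP[/eqP sg _].
by rewrite forest_weight_Node cat_take_drop size_takel ?sg ?leq_addl// mulrA.
Qed.

Lemma sum_forests_exchangeable (X : plane_tree -> R) m j i : (i < j)%N ->
  \sum_(f <- forests m j) forest_weight f * X (nth leaf f i) =
  \sum_(f <- forests m j) forest_weight f * X (head leaf f).
Proof.
move=> ltij.
(* moving the tree number i in front is a bijection between forests *)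
pose sw f := nth leaf f i :: (take i f ++ drop i.+1 f).
have swp f : size f = j -> perm_eq (sw f) f.
  move=> sf; rewrite -{2}(cat_take_drop i f) (drop_nth leaf) ?sf//.
  by rewrite perm_sym perm_catC /= perm_cons perm_catC.
have swF : perm_eq (map sw (forests m j)) (forests m j).
  have inj : {in forests m j &, injective sw}.
    move=> f g; rewrite !mem_forests => /andP[/eqP sf _] /andP[/eqP sg _].
    case=> fi /eqP; rewrite eqseq_cat ?size_takel ?sf ?sg ?(ltnW ltij)//.
    case/andP => /eqP tf /eqP df.
    rewrite -(cat_take_drop i f) -(cat_take_drop i g).
    by rewrite (drop_nth leaf) ?sf// [in RHS](drop_nth leaf) ?sg// fi tf df.
  apply: uniq_perm; rewrite ?uniq_forests ?map_inj_in_uniq ?uniq_forests//.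
  apply: (uniq_min_size _ _ _).2; rewrite ?map_inj_in_uniq ?uniq_forests//.
    move=> _ /mapP[f + ->]; rewrite !mem_forests => /andP[/eqP sf ff].
    rewrite (perm_size (swp _ sf)) sf eqxx /forest_size.
    by rewrite (perm_sumn (perm_map _ (swp _ sf))).
  by rewrite size_map.
rewrite -[RHS](perm_big _ swF) big_map big_seq [RHS]big_seq.
apply: eq_bigr => f; rewrite mem_forests => /andP[/eqP sf _].
by rewrite /= /forest_weight (perm_big _ (swp _ sf)).
Qed.

End Weights.

(** * Weighted counts of forests and of high nodes *)

Lemma coef_XnM_euler (R : nzRingType) (q : {poly R}) j m :
  ('X^j * ('X * q^`()))`_m + ('X^j * q)`_m *+ j = ('X^j * q)`_m *+ m.
Proof.
rewrite !coefXnM; have [ltmj|lejm] := ltnP m j; first by rewrite !mul0rn addr0.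
rewrite coefXM; have [|mj_gt0] := eqVneq (m - j)%N 0%N.
  by move=> mj0; rewrite mj0 add0r (_ : m = j)//; lia.
rewrite coef_deriv prednK ?lt0n// -mulrnDr; congr (_ *+ _); lia.
Qed.

Lemma coef_poly_shift (R : comNzRingType) (b : nat -> R) (q : {poly R}) N m j :
  (m < N)%N ->
  \sum_(c < m.+1) b c * ('X^(j + c) * q)`_m = ('X^j * \poly_(c < N) b c * q)`_m.
Proof.
move=> ltmN; rewrite poly_def big_distrr/= big_distrl/= coef_sum.
rewrite (big_ord_widen N (fun c => b c * ('X^(j + c) * q)`_m))//.
rewrite big_mkcond; apply: eq_bigr => c _ /=.
rewrite -scalerAr -scalerAl coefZ -exprD; case: ifP => // /negbT.
by rewrite -leqNgt coefXnM => ltmc; rewrite ifT ?mulr0//; lia.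
Qed.

Section TreeSums.
Context (R : realFieldType) (p : nat -> R).

(** The cut-off makes this a polynomial; it does not affect the coefficients
    below [N] of its powers, and only these are used. *)
Definition genpoly (N : nat) : {poly R} := \poly_(c < N) p c.

(** Its coefficients [c * p c] are the size-biased law, when [p] has mean 1. *)
Definition biaspoly (N : nat) : {poly R} := 'X * (genpoly N)^`().

Lemma biaspolyE N : biaspoly N = \poly_(c < N) (c%:R * p c).
Proof.
apply/polyP => c; rewrite coefXM coef_poly coef_deriv coef_poly.
case: c => [|c]/=; first by rewrite mul0r if_same.
by case: ifP; rewrite ?mul0rn// mulr_natl.
Qed.

(** The Otter-Dwass formula. When the first root is removed, a forest of [j]
    trees becomes one of [j + c - 1] trees with one node less; the induction
    closes because the size-biased coefficients are those of a derivative
    ([coef_XnM_euler]). *)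
Lemma sum_forest_weight N m j : (m < N)%N ->
  m%:R * (\sum_(f <- forests m j) forest_weight p f) =
  j%:R * ('X^j * genpoly N ^+ m)`_m.
Proof.
elim: m j => [|m IH] j ltmN.
  rewrite mul0r expr0 mulr1 coefXn.
  by case: j => [|j]; rewrite ?mul0r//= mulr0.
case: j => [|j]; first by rewrite big_nil mulr0 mul0r.
have mE : m.+1%:R * m%:R * (\sum_(f <- forests m.+1 j.+1) forest_weight p f) =
    m.+1%:R * ('X^j * \poly_(c < N) (p c * (j + c)%:R) * genpoly N ^+ m)`_m.
  rewrite -(coef_poly_shift _ _ _ (ltnW ltmN)) -mulrA; congr (_ * _).
  under eq_bigr do rewrite -[forest_weight _ _]mulr1.
  rewrite (sum_forests_first_root _ (fun=> 1)) big_distrr/=.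
  apply: eq_bigr => c _; rewrite mulrCA -mulrA -IH ?(ltnW ltmN)//.
  by under eq_bigr do rewrite mulr1.
have polyE : \poly_(c < N) (p c * (j + c)%:R) =
    genpoly N *+ j + biaspoly N.
  rewrite biaspolyE; apply/polyP => c; rewrite coefD coefMn !coef_poly.
  case: ifP; rewrite ?mul0rn ?addr0// natrD mulrDr => _.
  by rewrite mulr_natr mulrC; congr (_ + _); rewrite mulrC.
have [m0|m_gt0] := posnP m.
  rewrite m0 in ltmN *; rewrite mul1r expr1 forestsS big_flatten/= !big_seq1.
  rewrite big_map; case: j {mE polyE} => [|j]; last first.
    by rewrite big_nil coefXnM/= mulr0.
  rewrite big_seq1/= mul1r coefXM/= coef_poly (ltnW ltmN).
  rewrite /forest_weight big_seq1 weight_Node /forest_weight big_nil mulr1//.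
apply: (@mulfI _ m%:R); first by rewrite pnatr_eq0 -lt0n.
have := coef_XnM_euler (genpoly N ^+ m.+1) j m.
have -> : 'X * (genpoly N ^+ m.+1)^`() = biaspoly N * genpoly N ^+ m *+ m.+1.
  by rewrite deriv_exp/= -!mulrnAr mulrA.
rewrite mulrnAr coefMn => H.
rewrite mulrCA [RHS]mulrCA mulrA mE polyE.
have -> : 'X^j * (genpoly N *+ j + biaspoly N) * genpoly N ^+ m =
   'X^j * genpoly N ^+ m.+1 *+ j + 'X^j * (biaspoly N * genpoly N ^+ m).
  by rewrite mulrDr mulrDl mulrnAr mulrnAl exprS !mulrA.
rewrite coefD coefMn -[_ *+ j]mulr_natl mulrDr.
have -> : ('X^(j.+1) * genpoly N ^+ m.+1)`_(m.+1) = ('X^j * genpoly N ^+ m.+1)`_m.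
  by rewrite exprS -mulrA coefXM.
move: H; rewrite -[_ *+ m.+1]mulr_natl -[_ *+ j]mulr_natl -[_ *+ m]mulr_natl => H.
have -> : m.+1%:R * ('X^j * (biaspoly N * genpoly N ^+ m))`_m =
  m%:R * ('X^j * genpoly N ^+ m.+1)`_m - j%:R * ('X^j * genpoly N ^+ m.+1)`_m.
  by rewrite -H addrK.
move: (_`_m) => x; rewrite -!natr1; ring.
Qed.

Definition nb_above (k : nat) (t : plane_tree) : nat :=
  count (fun u => (k <= size u)%N) (nodes t).

Lemma nb_above0 t : nb_above 0 t = tree_size t.
Proof. exact: count_predT. Qed.

Lemma nb_aboveS k ts :
  nb_above k.+1 (Node ts) = (\sum_(i < size ts) nb_above k (nth leaf ts i))%N.
Proof.
rewrite /nb_above -sum1_count big_mkcond big_nodes/= add0n.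
by apply: eq_bigr => i _; rewrite -sum1_count [RHS]big_mkcond.
Qed.

(** The root of the first tree has [c] children with weight [p c], and by
    exchangeability each of these contributes as much as the first tree of the
    forest that is left when this root is removed. So each generation costs a factor [c * p c],
    and the factors [p c] of the nodes off the spine remain. *)
Lemma sum_nb_above k N m j : (0 < j)%N -> (k <= m < N)%N ->
  \sum_(f <- forests m j) forest_weight p f * (nb_above k (head leaf f))%:R =
  ('X^j * biaspoly N ^+ k * genpoly N ^+ (m - k))`_m.
Proof.
elim: k m j => [|k IH] m j j_gt0 /andP[lekm ltmN].
  apply: (@mulfI _ j%:R); first by rewrite pnatr_eq0 -lt0n.
  rewrite expr0 mulr1 subn0 -sum_forest_weight//.
  transitivity (\sum_(i < j) \sum_(f <- forests m j)
      forest_weight p f * (tree_size (nth leaf f i))%:R).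
    under [RHS]eq_bigr => i _ do rewrite
      (sum_forests_exchangeable p (fun t => (tree_size t)%:R))//.
    rewrite sumr_const card_ord mulr_natl.
    by under eq_bigr do rewrite nb_above0.
  rewrite exchange_big mulr_sumr/= big_seq [RHS]big_seq.
  apply: eq_bigr => f; rewrite mem_forests => /andP[/eqP sf /eqP fsf].
  rewrite -mulr_sumr mulrC -natr_sum -fsf /forest_size sumnE big_map.
  by rewrite (big_nth leaf) big_mkord sf.
case: m lekm ltmN => // m lekm ltmN; case: j j_gt0 => // j _.
rewrite (sum_forests_first_root p (fun f => (nb_above k.+1 (head leaf f))%:R)).
transitivity (\sum_(c < m.+1) c%:R * p c *
   ('X^(j + c) * (biaspoly N ^+ k * genpoly N ^+ (m - k)))`_m).
  apply: eq_bigr => c _ /=; rewrite mulrAC mulrC; congr (_ * _).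
  transitivity (\sum_(i < c) \sum_(g <- forests m (j + c))
      forest_weight p g * (nb_above k (nth leaf g i))%:R).
    rewrite exchange_big/= big_seq [RHS]big_seq; apply: eq_bigr => g.
    rewrite mem_forests => /andP[/eqP sg _]; rewrite -mulr_sumr; congr (_ * _).
    rewrite -natr_sum nb_aboveS size_takel ?sg ?leq_addl//; congr _%:R.
    by apply: eq_bigr => i _; rewrite nth_take.
  case: c => -[|c] ltcm /=; first by rewrite big_ord0 mul0r.
  under eq_bigr => i _ do rewrite
    (sum_forests_exchangeable p (fun t => (nb_above k t)%:R)
       _ (leq_trans (ltn_ord i) (leq_addl j c.+1)))//.
  rewrite sumr_const card_ord mulr_natl IH ?mulrA//; lia.
rewrite (coef_poly_shift (fun c => c%:R * p c) _ _ (ltnW ltmN)) -biaspolyE.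
by rewrite !exprS subSS -!mulrA coefXM/= !mulrA.
Qed.

End TreeSums.

(** * The price of conditioning on the size *)

Lemma expR_ge_exprn (R : realType) (n : nat) (x : R) : 0 <= x ->
  (1 + x / n.+1%:R) ^+ n.+1 <= expR x.
Proof.
move=> x0; have -> : expR x = expR (x / n.+1%:R) ^+ n.+1.
  by rewrite -expRM_natl mulrC divfK// pnatr_eq0.
apply: lerXn2r; rewrite ?nnegrE ?expR_ge0 ?expR_ge1Dx//.
by rewrite addr_ge0// divr_ge0.
Qed.

Lemma sum_inv_sqr_tail (R : realType) a n : (0 < a <= n)%N ->
  \sum_(a <= j < n) ((j.+1%:R : R) ^+ 2)^-1 <= a%:R^-1 - n%:R^-1.
Proof.
case/andP=> a0; elim: n => [|n IH]; first by rewrite leqNgt a0.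
rewrite leq_eqVlt => /orP[/eqP->|an]; first by rewrite big_geq ?subrr.
rewrite ltnS in an; rewrite big_nat_recr//=.
apply: (le_trans (lerD (IH an) (lexx _))); rewrite -subr_ge0.
have : 0 < n%:R :> R by rewrite ltr0n (leq_trans a0).
rewrite -natr1; move: (n%:R) => x x0.
rewrite (_ : _ - _ = (x * (x + 1) ^+ 2)^-1).
  by rewrite invr_ge0 mulr_ge0 ?sqr_ge0// ltW.
have a1 : a%:R != 0 :> R by rewrite pnatr_eq0 -lt0n.
by field; rewrite a1 !gt_eqF//; lra.
Qed.

Lemma sum_inv_sqr_le (R : realType) n :
  \sum_(j < n) ((j.+1%:R : R) ^+ 2)^-1 <= 2.
Proof.
rewrite -(big_mkord xpredT (fun j => (j.+1%:R ^+ 2)^-1)).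
case: n => [|n]; first by rewrite big_geq.
rewrite big_ltn// expr1n invr1.
have := @sum_inv_sqr_tail R 1 n.+1 isT; rewrite invr1 => h.
apply: (le_trans (lerD (lexx _) h)).
have : 0 <= n.+1%:R^-1 :> R by rewrite invr_ge0.
by move: (_^-1) => y; lra.
Qed.

Lemma bernoulli_ineq (R : realType) (x : R) m :
  0 <= x <= 1 -> 1 - m%:R * x <= (1 - x) ^+ m.
Proof.
move=> /andP[x0 x1]; elim: m => [|m IH]; first by rewrite mul0r subr0 expr0.
rewrite exprS; apply: (@le_trans _ _ ((1 - x) * (1 - m%:R * x))).
  rewrite -natr1 -subr_ge0 (_ : _ - _ = m%:R * x ^+ 2); last by ring.
  by rewrite mulr_ge0// sqr_ge0.
by rewrite ler_wpM2l// subr_ge0.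
Qed.

Lemma archi_nat (R : realType) (x : R) : exists n : nat, x <= n%:R.
Proof.
exists (Num.bound `|x|); apply: le_trans (ler_norm _) _.
exact/ltW/archi_boundP.
Qed.

(** Markov's inequality. If [b] is the generating function of a finite measure,
    [b.[1]] is its mass and [b^`().[1]] its first moment, and the measure of the
    values at most [k] is controlled by both. *)
Lemma poly_markov (R : realFieldType) (b : {poly R}) (g : nat -> R) k S :
  (size b <= S)%N -> (forall i, 0 <= b`_i) -> (forall i, 0 <= g i) ->
  (forall i, (i <= k)%N -> g k <= g i) ->
  g k * (k.+1%:R * b.[1] - b^`().[1]) <= k.+1%:R * \sum_(i < S) b`_i * g i.
Proof.
move=> szb b0 g0 gk.
have -> : b^`().[1] = \sum_(i < S) i%:R * b`_i.
  have -> : b^`().[1] = ('X * b^`()).[1] by rewrite hornerM hornerX mul1r.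
  rewrite (@horner_coef_wide _ S).
    apply: eq_bigr => i _; rewrite expr1n mulr1 coefXM coef_deriv mulr_natl.
    by case: i => -[|i].
  have [->|nzb] := eqVneq b 0; first by rewrite deriv0 mulr0 size_poly0.
  apply: leq_trans szb; rewrite mulrC.
  have [->|nzb'] := eqVneq b^`() 0; first by rewrite mul0r size_poly0.
  by rewrite size_mulX// lt_size_deriv.
rewrite (horner_coef_wide _ szb) !mulr_sumr -sumrB mulr_sumr.
apply: ler_sum => i _; rewrite expr1n mulr1 -mulrBl.
rewrite [leLHS]mulrA (mulrC _ b`_i) [leRHS]mulrCA.
apply: ler_wpM2l => //.
have [ik|ki] := leqP i k; last first.
  apply: (@le_trans _ _ 0); last by rewrite mulr_ge0.
  by rewrite mulr_ge0_le0// subr_le0 ler_nat.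
apply: (@le_trans _ _ (g k * k.+1%:R)).
  by rewrite ler_wpM2l// lerBlDr lerDl.
by rewrite mulrC ler_wpM2l// gk.
Qed.

Section LowerBound.
Context (R : realType) (p : nat -> R).
Hypothesis p_ge0 : forall c, 0 <= p c.
Hypothesis mass_le1 : forall N, \sum_(c < N) p c <= 1.
Hypothesis mass1 : forall e : R, 0 < e -> exists N, 1 - e <= \sum_(c < N) p c.
Hypothesis mean_le1 : forall N, \sum_(c < N) c%:R * p c <= 1.
Hypothesis var_oo : forall K : R, exists N, K <= \sum_(c < N) c%:R ^+ 2 * p c.

Lemma coef_genpoly_exp N N' m s : (s < N)%N -> (s < N')%N ->
  (genpoly p N ^+ m)`_s = (genpoly p N' ^+ m)`_s.
Proof.
elim: m s => [|m IH] s sN sN'; first by [].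
rewrite !exprS !coefM; apply: eq_bigr => i _; rewrite !coef_poly.
have is_ := ltn_ord i; rewrite ltnS in is_.
rewrite (leq_ltn_trans is_ sN) (leq_ltn_trans is_ sN'); congr (_ * _).
by apply: IH; rewrite (leq_ltn_trans (leq_subr _ _)).
Qed.

(** The probability that [m] independent variables of law [p] have sum [s]. *)
Definition convpow (m s : nat) : R := (genpoly p s.+1 ^+ m)`_s.

Lemma convpowE N m s : (s < N)%N -> (genpoly p N ^+ m)`_s = convpow m s.
Proof. by move=> sN; apply: coef_genpoly_exp. Qed.

Lemma coef_exp_ge0 (q : {poly R}) m s :
  (forall i, 0 <= q`_i) -> 0 <= (q ^+ m)`_s.
Proof.
move=> q0; elim: m s => [|m IH] s; first by rewrite expr0 coef1 ler0n.
by rewrite exprS coefM; apply: sumr_ge0 => i _; rewrite mulr_ge0.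
Qed.

Lemma genpoly_ge0 N i : 0 <= (genpoly p N)`_i.
Proof. by rewrite coef_poly; case: ifP. Qed.

Lemma convpow_ge0 m s : 0 <= convpow m s.
Proof. by apply: coef_exp_ge0; exact: genpoly_ge0. Qed.

Lemma convpow1 c : convpow 1 c = p c.
Proof. by rewrite /convpow expr1 coef_poly ltnSn. Qed.

Lemma convpowM m m' s s' :
  convpow m s * convpow m' s' <= convpow (m + m') (s + s').
Proof.
rewrite {3}/convpow exprD coefM.
have ss' : (s < (s + s').+1)%N by rewrite ltnS leq_addr.
rewrite (bigD1 (Ordinal ss'))//= addKn !convpowE ?ltnS ?leq_addr ?leq_addl//.
by rewrite lerDl sumr_ge0// => i _; rewrite mulr_ge0// coef_exp_ge0//;
   exact: genpoly_ge0.
Qed.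

Lemma convpowX m s q : convpow m s ^+ q <= convpow (q * m) (q * s).
Proof.
elim: q => [|q IH]; first by rewrite /convpow !expr0 coef1.
rewrite exprS !mulSn; apply: le_trans (convpowM _ _ _ _).
by rewrite ler_wpM2l ?convpow_ge0.
Qed.

(** Markov's inequality for a sum of [m] variables of mean at most 1 bounds the
    probability that it exceeds [m]; the rest of the mass sits on the [m + 1]
    values up to [m], one of which must therefore be rather likely. *)
Lemma convpow_pigeonhole m :
  exists2 s, (s <= m)%N & (2 * m.+1%:R ^+ 2)^-1 <= convpow m s.
Proof.
apply: contrapT => nex.
have small s : (s <= m)%N -> convpow m s < (2 * m.+1%:R ^+ 2)^-1.
  by move=> sm; rewrite ltNge; apply/negP => lts; apply: nex; exists s.
have m1_gt0 : 0 < m.+1%:R :> R by rewrite ltr0n.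
(* the cut-off loses so little mass that the bound [1 / (m + 1)] of Markov's
   inequality is at worst halved *)
have e_gt0 : 0 < (2 * m.+1%:R ^+ 2)^-1 :> R.
  by rewrite invr_gt0 mulr_gt0// exprn_gt0.
have [L0 massL0] := mass1 e_gt0.
pose L := maxn L0 m.+1; set e := _^-1 in e_gt0 massL0 small.
have L_gt : (m < L)%N by rewrite leq_max ltnSn orbT.
have massL : 1 - e <= \sum_(c < L) p c.
  apply: le_trans massL0 _.
  rewrite (big_ord_widen L p (leq_maxl _ _)) big_mkcond/=.
  by apply: ler_sum => i _; case: ifP.
set q := genpoly p L ^+ m.
have massE : (genpoly p L).[1] = \sum_(c < L) p c.
  rewrite (horner_coef_wide _ (size_poly _ _)); apply: eq_bigr => i _.
  by rewrite expr1n mulr1 coef_poly ltn_ord.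
have q1 : 1 - m%:R * e <= q.[1].
  rewrite horner_exp massE.
  have e01 : 0 <= e <= 1.
    rewrite ltW//= invf_le1 ?mulr_gt0 ?exprn_gt0// -natrX -natrM ler1n.
    by rewrite muln_gt0 expn_gt0.
  apply: le_trans (bernoulli_ineq _ e01) _.
  by case/andP: e01 => _ e1; apply: lerXn2r => //; rewrite nnegrE ?sumr_ge0// subr_ge0.
have massL1 : (genpoly p L).[1] <= 1 by rewrite massE mass_le1.
have mass0 : 0 <= (genpoly p L).[1] by rewrite massE sumr_ge0.
have biasE : (genpoly p L)^`().[1] = \sum_(c < L) c%:R * p c.
  have -> : (genpoly p L)^`().[1] = (biaspoly p L).[1].
    by rewrite hornerM hornerX mul1r.
  rewrite biaspolyE (horner_coef_wide _ (size_poly _ _)); apply: eq_bigr => c _.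
  by rewrite expr1n mulr1 coef_poly ltn_ord.
have q'1 : q^`().[1] <= m%:R.
  rewrite deriv_exp hornerMn hornerM horner_exp -mulr_natl.
  rewrite ler_piMr//; apply: mulr_ile1; rewrite ?exprn_ge0 ?exprn_ile1//.
    rewrite biasE; apply: sumr_ge0 => c _; rewrite mulr_ge0//.
  by rewrite biasE.
have q0 i : 0 <= q`_i by apply: coef_exp_ge0; exact: genpoly_ge0.
have := @poly_markov _ q (fun i => (i <= m)%N%:R) m (maxn (size q) m.+1)
   (leq_maxl _ _) q0 (fun=> ler0n _ _).
rewrite leqnn mul1r => /(_ _)/wrap[i ->//|].
apply/negP; rewrite -ltNge.
under eq_bigr do rewrite mulr_natr mulrb.
rewrite -big_mkcond/= -(big_ord_widen _ (fun i => q`_i) (leq_maxr _ _)).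
have : \sum_(i < m.+1) q`_i < \sum_(i < m.+1) e.
  apply: ltr_sum; first by apply/hasP; exists ord0; rewrite // mem_index_enum.
  move=> i _; rewrite convpowE; first by apply: small; rewrite -ltnS.
  exact: leq_trans (ltn_ord i) L_gt.
rewrite sumr_const card_ord -[e *+ _]mulr_natl => lts.
have eE : m.+1%:R * (m.+1%:R * e) = 2^-1.
  by rewrite mulrA /e; field; rewrite addr_eq0; lra.
have := ler_wpM2l (ltW m1_gt0) q1.
have : m.+1%:R * (\sum_(i < m.+1) q`_i) < 2^-1 by rewrite -eE (ltr_pM2l m1_gt0).
have : m%:R * e <= m.+1%:R * e by rewrite ler_wpM2r ?ler_nat// ltW.
move=> h1 h2 h3; have := ler_wpM2l (ltW m1_gt0) h1; rewrite eE.
rewrite mulrBr mulr1 in h3; have m1E : m%:R + 1 = m.+1%:R :> R by exact: natr1.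
clearbody e; lra.
Qed.

(** Otherwise [c ^ 4 * p c] would be bounded and the second moment finite. *)
Lemma heavy_atom (eta : R) : 0 < eta ->
  exists2 c, (1 < c)%N & expR (- (eta * c.-1%:R)) <= p c.
Proof.
move=> eta0; apply: contrapT => nex.
have small c : (1 < c)%N -> p c <= expR (- (eta * c.-1%:R)).
  by move=> c1; rewrite leNgt; apply/negP => /ltW lts; apply: nex; exists c.
pose C : R := 1 + (8 / eta) ^+ 4.
have C0 : 0 <= (8 / eta) ^+ 4 by rewrite exprn_ge0// divr_ge0// ltW.
have p1 c : p c <= 1.
  apply: le_trans (mass_le1 c.+1).
  by rewrite big_ord_recr/= lerDr sumr_ge0.
have bound c : c%:R ^+ 4 * p c <= C.
  case: c => [|[|c]]; first by rewrite expr0n mul0r /C; lra.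
    by rewrite expr1n mul1r /C; have := p1 1%N; lra.
  apply: (@le_trans _ _ (c.+2%:R ^+ 4 * expR (- (eta * c.+1%:R)))).
    by rewrite ler_wpM2l ?exprn_ge0// small.
  have x0 : 0 <= eta * c.+1%:R by rewrite mulr_ge0// ltW.
  rewrite expRN ler_pdivrMr ?expR_gt0//.
  apply: (@le_trans _ _ ((8 / eta) ^+ 4 * (eta * c.+1%:R / 4) ^+ 4)).
    rewrite -exprMn; apply: lerXn2r; rewrite ?nnegrE ?mulr_ge0//.
    - by rewrite invr_ge0 ltW.
    - by rewrite ltW.
    rewrite (_ : _ * _ = 2 * c.+1%:R); last by field; rewrite gt_eqF.
    by rewrite -natrM ler_nat; lia.
  apply: ler_pM; rewrite ?exprn_ge0 ?divr_ge0 ?mulr_ge0//; try exact: ltW.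
    by rewrite /C; lra.
  apply: le_trans (expR_ge_exprn 3 x0).
  apply: lerXn2r; rewrite ?nnegrE ?addr_ge0 ?divr_ge0 ?mulr_ge0//; try exact: ltW.
  by rewrite lerDr.
have [N] := var_oo (C * 2 + 1).
apply/negP; rewrite -ltNge; apply: (@le_lt_trans _ _ (C * 2)); last by lra.
case: N => [|N]; first by rewrite big_ord0 mulr_ge0//; rewrite /C; lra.
rewrite big_ord_recl expr0n mul0r add0r.
apply: (@le_trans _ _ (C * \sum_(c < N) (c.+1%:R ^+ 2)^-1)); last first.
  by rewrite ler_wpM2l ?sum_inv_sqr_le//; rewrite /C; lra.
rewrite mulr_sumr; apply: ler_sum => c _; rewrite ler_pdivlMr ?exprn_gt0//.
by rewrite mulrAC -exprD; exact: bound.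
Qed.

(** Combine [c - 1] blocks of [m] variables of sum [m - w] with [w] single
    variables equal to [c]: the sum is the number of variables. The pigeonhole
    bound is polynomial in [m] and [p c] is subexponential in [c], so that the
    cost per variable is small. *)
Lemma convpow_diag (delta : R) : 0 < delta ->
  exists2 L, (0 < L)%N & expR (- (delta * L%:R)) <= convpow L L.
Proof.
move=> d0; have [m0 m0P] := archi_nat (8 * (6 / delta) ^+ 3).
pose m := m0.+1; have [s sm sP] := convpow_pigeonhole m.
have [c c1 cP] := heavy_atom (divr_gt0 d0 (ltr0n _ 2)).
exists (c.-1 * m + (m - s))%N; first by rewrite addn_gt0 muln_gt0; case: c c1 {cP}=> [|[]].
have mP : expR (- (delta / 2 * m%:R)) <= convpow m s.
  apply: le_trans sP; rewrite expRN lef_pV2 ?posrE ?expR_gt0 ?mulr_gt0 ?exprn_gt0//.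
  have x0 : 0 <= delta / 2 * m%:R by rewrite mulr_ge0// divr_ge0// ltW.
  apply: le_trans (expR_ge_exprn 2 x0).
  apply: (@le_trans _ _ ((delta / 2 * m%:R / 3) ^+ 3)); last first.
    apply: lerXn2r; rewrite ?nnegrE ?addr_ge0 ?divr_ge0//.
    by rewrite lerDr.
  apply: (@le_trans _ _ (8 * m%:R ^+ 2)).
    rewrite (_ : 8 * m%:R ^+ 2 = 2 * (2 * m%:R) ^+ 2); last by ring.
    rewrite ler_wpM2l//; apply: lerXn2r; rewrite ?nnegrE//.
    by rewrite -natrM ler_nat /m; lia.
  rewrite (_ : _ ^+ 3 = ((delta / 6) ^+ 3 * m%:R) * m%:R ^+ 2); last first.
    by field.
  rewrite ler_wpM2r ?exprn_ge0// mulrC -ler_pdivrMr ?exprn_gt0 ?divr_gt0//.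
  rewrite -exprVn invf_div (le_trans m0P)// ler_nat /m; exact: leqnSn.
have -> : (c.-1 * m + (m - s) = c.-1 * m + (m - s) * 1)%N by rewrite muln1.
have {3}-> : (c.-1 * m + (m - s) * 1 = c.-1 * s + (m - s) * c)%N.
  by case: c c1 {cP} => // c _ /=; nia.
apply: le_trans (convpowM _ _ _ _).
apply: le_trans (ler_pM _ _ (convpowX _ _ _) (convpowX _ _ _)); last 2 first.
- by rewrite exprn_ge0// convpow_ge0.
- by rewrite exprn_ge0// convpow_ge0.
rewrite convpow1.
apply: (@le_trans _ _ (expR (- (delta / 2 * m%:R)) ^+ c.-1 *
    expR (- (delta / 2 * c.-1%:R)) ^+ (m - s))); last first.
  by apply: ler_pM; rewrite ?exprn_ge0 ?expR_ge0//; apply: lerXn2r;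
     rewrite ?nnegrE ?expR_ge0 ?convpow_ge0.
rewrite -!expRM_natl -expRD ler_expR -!mulrN.
have : (m - s)%:R <= m%:R :> R by rewrite ler_nat leq_subr.
have w0 : 0 <= (m - s)%:R :> R by [].
rewrite muln1 natrD natrM.
move: ((m - s)%:R) w0 => w w0 wm; rewrite -subr_ge0.
rewrite (_ : _ - _ = delta / 2 * c.-1%:R * (m%:R - w) + delta * w); last by field.
by rewrite addr_ge0// !mulr_ge0// ?subr_ge0// ltW.
Qed.

(** Conditioning a sum of [n] variables to be [n - 1] costs at most a
    subexponential factor: [convpow] is supermultiplicative, so the cheap blocks
    of [convpow_diag] can be repeated. *)
Lemma convpow_subexponential (delta : R) : 0 < delta ->
  exists n0, forall n, (n0 <= n)%N -> 0 < convpow n n.-1 ->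
    expR (- (delta * n%:R)) <= convpow n n.-1.
Proof.
move=> d0; have [L L0 LP] := convpow_diag (divr_gt0 d0 (ltr0n _ 2)).
(* [n] is reached from the least admissible size in its class modulo [L] by
   adding blocks of length [L] *)
have class r : exists2 K : R, 0 < K & forall n, (n %% L = r)%N ->
    (0 < n)%N -> 0 < convpow n n.-1 -> K * expR (- (delta / 2 * n%:R)) <= convpow n n.-1.
  have [ex|nex] := pselect (exists n,
      [&& (n %% L == r)%N, (0 < n)%N & 0 < convpow n n.-1]); last first.
    exists 1 => // n nr n0 np; exfalso; apply: nex; exists n.
    by rewrite nr eqxx n0.
  case: (ex_minnP ex) => a /and3P[/eqP ar a0 ap] amin.
  exists (convpow a a.-1) => // n nr n0 np.
  have an : (a <= n)%N by apply: amin; rewrite nr eqxx n0.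
  have [q nE] : exists q, n = (a + q * L)%N.
    exists ((n - a) %/ L)%N; rewrite divnK ?subnKC// -eqn_mod_dvd//.
    by rewrite nr ar.
  rewrite {2}nE (_ : n.-1 = (a.-1 + q * L)%N); last by rewrite nE; lia.
  apply: le_trans (convpowM _ _ _ _); apply: ler_wpM2l; first exact: ltW.
  apply: le_trans (convpowX _ _ _).
  apply: (@le_trans _ _ (expR (- (delta / 2 * L%:R)) ^+ q)); last first.
    by apply: lerXn2r; rewrite ?nnegrE ?expR_ge0 ?convpow_ge0.
  rewrite -expRM_natl ler_expR nE natrD natrM mulrN lerN2 mulrCA mulrDr lerDr.
  by rewrite mulr_ge0// divr_ge0// ltW.
have [K K0 KP] : exists2 K : R, 0 < K & forall n, (0 < n)%N ->
    0 < convpow n n.-1 -> K * expR (- (delta / 2 * n%:R)) <= convpow n n.-1.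
  suff [K K0 KP] : exists2 K : R, 0 < K & forall n, (n %% L < L)%N -> (0 < n)%N ->
    0 < convpow n n.-1 -> K * expR (- (delta / 2 * n%:R)) <= convpow n n.-1.
    by exists K => // n; apply: KP; rewrite ltn_mod.
  move: {2}L => B; elim: B => [|B [K K0 KP]]; first by exists 1.
  have [K' K'0 K'P] := class B; exists (Num.min K K'); first by rewrite lt_min K0.
  move=> n; rewrite ltnS leq_eqVlt => /orP[/eqP nB|nB] n0 np.
    apply: le_trans (K'P n nB n0 np).
    by rewrite ler_wpM2r ?expR_ge0// ge_min lexx orbT.
  apply: le_trans (KP n nB n0 np).
  by rewrite ler_wpM2r ?expR_ge0// ge_min lexx.
have [n1 n1P] := archi_nat (2 / delta * - ln K).
exists n1.+1 => n n1n np; apply: le_trans (KP n (leq_ltn_trans (leq0n _) n1n) np).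
rewrite -{1}(lnK K0) -expRD ler_expR -subr_ge0.
have : 2 / delta * - ln K <= n%:R.
  by apply: (le_trans n1P); rewrite ler_nat ltnW.
have d2 : 0 <= delta / 2 by rewrite divr_ge0// ltW.
move=> /(ler_wpM2l d2); rewrite (_ : _ * (_ * _) = - ln K); first by lra.
by field; rewrite gt_eqF.
Qed.

End LowerBound.

(** * The height of a uniform node *)

Lemma coef_poly_exp (R : comNzRingType) (q : nat -> R) N n s :
  ((\poly_(c < N) q c) ^+ n)`_s =
  \sum_(f : {ffun 'I_n -> 'I_N} | (\sum_(i < n) f i == s)%N) \prod_(i < n) q (f i).
Proof.
have -> : (\poly_(c < N) q c) ^+ n =
    \sum_(f : {ffun 'I_n -> 'I_N}) (\prod_(i < n) q (f i)) *: 'X^(\sum_(i < n) f i).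
  rewrite poly_def -[in LHS](card_ord n) -prodr_const bigA_distr_bigA/=.
  apply: eq_bigr => f _; rewrite scaler_prod; congr (_ *: _).
  by rewrite (big_morph _ (exprD 'X) (expr0 'X)).
rewrite coef_sum [RHS]big_mkcond; apply: eq_bigr => f _.
by rewrite coefZ coefXn eq_sym; case: eqP; rewrite ?mulr1 ?mulr0.
Qed.

(** This passes from a large exponential rate [l] to a small one [s]; it is used
    with a level [B] for which the second factor is bounded in mean. *)
Lemma exp_mix_le (R : realType) (s l B H : R) : 0 <= s <= l ->
  expR (- (s * H)) <= expR (- (s * B)) * (1 + expR (l * B) * expR (- (l * H))).
Proof.
move=> /andP[s0 sl].
rewrite (_ : - (s * H) = - (s * B) + s * (B - H)); last by ring.
rewrite expRD ler_wpM2l ?expR_ge0// -expRD -mulrN -mulrDr.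
have [BH|BH] := leP 0 (B - H).
  apply: (@le_trans _ _ (expR (l * (B - H)))); last by rewrite lerDr.
  by rewrite ler_expR ler_wpM2r.
apply: (@le_trans _ _ 1); last by rewrite lerDl expR_ge0.
by rewrite -expR0 ler_expR mulr_ge0_le0// ltW.
Qed.

Lemma expRN_le (R : realType) (y : R) : 0 <= y <= 1 -> expR (- y) <= 1 - y / 2.
Proof.
move=> /andP[y0 y1]; rewrite expRN; apply: (@le_trans _ _ (1 + y)^-1).
  by rewrite lef_pV2 ?posrE ?expR_gt0 ?expR_ge1Dx//; lra.
rewrite -div1r ler_pdivrMr; last by lra.
by nra.
Qed.

(** This strengthens [1 + x <= exp x] to second order. *)
Lemma expR_ge1_sqr (R : realType) (x : R) : 0 <= x <= 2^-1 ->
  1 + x <= expR (x - x ^+ 2 / 8).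
Proof.
move=> /andP[x0 x1]; have y0 : 0 <= x - x ^+ 2 / 8 by nra.
apply: le_trans (expR_ge_exprn 1 y0).
set y := _ - _ in y0 *.
have xy : 15 / 16 * x <= y by rewrite /y; nra.
have : (15 / 16 * x) ^+ 2 <= y ^+ 2.
  by apply: lerXn2r; rewrite ?nnegrE//; lra.
rewrite (_ : (1 + y / 2) ^+ 2 = 1 + y + y ^+ 2 / 4); last by field.
by rewrite /y => h; nra.
Qed.

Section DepthTail.
Context (R : realType) (p : nat -> R).
Hypothesis p_ge0 : forall c, 0 <= p c.
Hypothesis mass_le1 : forall N, \sum_(c < N) p c <= 1.
Hypothesis mass1 : forall e : R, 0 < e -> exists N, 1 - e <= \sum_(c < N) p c.
Hypothesis mean_le1 : forall N, \sum_(c < N) c%:R * p c <= 1.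
Hypothesis var_oo : forall K : R, exists N, K <= \sum_(c < N) c%:R ^+ 2 * p c.

(** The probability that the sum of [n] independent offspring numbers is
    [n - 1], weighted by the product of the first [k] of them. *)
Definition spine_sum (n k : nat) : R :=
  (biaspoly p n.+1 ^+ k * genpoly p n.+1 ^+ (n - k))`_n.-1.

Lemma biaspoly_ge0 N i : 0 <= (biaspoly p N)`_i.
Proof. by rewrite biaspolyE coef_poly; case: ifP => // _; rewrite mulr_ge0. Qed.

Lemma spine_sum_ge0 n k : 0 <= spine_sum n k.
Proof.
rewrite /spine_sum coefM; apply: sumr_ge0 => i _.
by rewrite mulr_ge0// coef_exp_ge0// => j; [exact: biaspoly_ge0 | exact: genpoly_ge0].
Qed.

Lemma spine_sum0 n : (0 < n)%N -> spine_sum n 0 = convpow p n n.-1.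
Proof. by move=> n0; rewrite /spine_sum mul1r subn0 convpowE//; lia. Qed.

Lemma spine_sum_nb_above n k : (0 < n)%N -> (k <= n)%N ->
  spine_sum n k =
  \sum_(f <- forests n 1) forest_weight p f * (nb_above k (head leaf f))%:R.
Proof.
move=> n0 kn; rewrite (@sum_nb_above _ _ k n.+1)//; last by rewrite kn/=.
by rewrite -mulrA coefXnM; case: n n0 kn => // n _ _; rewrite subSS subn0.
Qed.

Lemma weight_ge0 t : 0 <= weight p t.
Proof. exact: prodr_ge0. Qed.

Lemma forest_weight_ge0 f : 0 <= forest_weight p f.
Proof. by apply: prodr_ge0 => t _; exact: weight_ge0. Qed.

Lemma spine_sum_mono n i k : (0 < n)%N -> (i <= k <= n)%N ->
  spine_sum n k <= spine_sum n i.
Proof.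
move=> n0 /andP[ik kn]; rewrite !spine_sum_nb_above//; last exact: leq_trans kn.
apply: ler_sum => f _; rewrite ler_wpM2l ?forest_weight_ge0// ler_nat.
by apply: sub_count => u; exact: leq_trans.
Qed.

(** The offspring law, tilted by the mixture with weights [1 - u] and [u] of the
    factors 1 and [c]. *)
Definition mixpoly (u : R) N : {poly R} :=
  \poly_(c < N) (p c * (1 + u * (c%:R - 1))).

(** The mixture over [k] of the [spine_sum n k] with binomial weights is
    explicit by the binomial theorem; [k |-> spine_sum n k] being decreasing,
    its values are controlled by this mixture. *)
Lemma spine_sum_le_mix (u : R) n k : 0 <= u <= 1 -> (0 < n)%N -> (k <= n)%N ->
  n%:R * u <= k%:R / 2 -> spine_sum n k <= 2 * (mixpoly u n.+1 ^+ n)`_n.-1.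
Proof.
move=> /andP[u0 u1] n0 kn nu.
pose b : {poly R} := ((1 - u)%:P + u *: 'X) ^+ n.
have u1' : 0 <= 1 - u by rewrite subr_ge0.
have bE i : (i <= n)%N -> b`_i = (1 - u) ^+ (n - i) * u ^+ i *+ 'C(n, i).
  move=> ile; rewrite /b exprDn coef_sum (bigD1 (Ordinal (ile : i < n.+1)%N))//=.
  rewrite big1 ?addr0 => [|j]; last first.
    rewrite -val_eqE/= => ji.
    rewrite coefMn -rmorphXn coefCM exprZn coefZ coefXn eq_sym (negPf ji).
    by rewrite !mulr0 mul0rn.
  by rewrite coefMn -rmorphXn coefCM exprZn coefZ coefXn eqxx mulr1.
have szb : (size b <= n.+1)%N.
  have h : (size ((1 - u)%:P + u *: 'X : {poly R})%R <= 2)%N.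
    rewrite (leq_trans (size_polyD _ _))// geq_max size_polyC.
    rewrite (leq_trans (size_scale_leq _ _)) ?size_polyX// andbT.
    by case: eqP.
  apply: leq_trans (size_poly_exp_leq _ _) _; rewrite ltnS.
  by move: (size _) h => [|[|[|//]]] _; rewrite /= ?mul0n ?mul1n.
have b0 i : 0 <= b`_i.
  have [ile|nlei] := leqP i n; last by rewrite nth_default// (leq_trans szb).
  by rewrite bE// mulrn_wge0// mulr_ge0// exprn_ge0.
have b1 : b.[1] = 1 by rewrite horner_exp !hornerE subrK expr1n.
have b'1 : b^`().[1] = n%:R * u.
  rewrite deriv_exp hornerMn hornerM horner_exp !hornerE subrK expr1n mulr1.
  by rewrite derivD derivC derivZ derivX !hornerE mulr_natl.
have := poly_markov szb b0 (spine_sum_ge0 n) (k := k).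
rewrite b1 b'1 mulr1.
have -> : \sum_(i < n.+1) b`_i * spine_sum n i = (mixpoly u n.+1 ^+ n)`_n.-1.
  have -> : mixpoly u n.+1 = (1 - u) *: genpoly p n.+1 + u *: biaspoly p n.+1.
    rewrite biaspolyE; apply/polyP => c; rewrite coefD !coefZ !coef_poly.
    by case: ifP; rewrite ?mulr0 ?addr0// => _; ring.
  rewrite exprDn coef_sum; apply: eq_bigr => i _.
  rewrite bE; last by rewrite -ltnS.
  rewrite coefMn !exprZn -scalerAl.
  rewrite -scalerAr.
  rewrite !coefZ.
  rewrite mulrnAl mulrA.
  by rewrite /spine_sum (mulrC (biaspoly _ _ ^+ _)).
have mono i : (i <= k)%N -> spine_sum n k <= spine_sum n i.
  by move=> ik; apply: spine_sum_mono; rewrite // ik.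
move=> /(_ mono) h.
have k1 : 0 < k.+1%:R :> R by rewrite ltr0n.
rewrite -(ler_pM2l k1) mulrCA.
have : spine_sum n k * (k.+1%:R / 2) <= spine_sum n k * (k.+1%:R - n%:R * u).
  by rewrite ler_wpM2l ?spine_sum_ge0//; have := natr1 (R := R) k; lra.
by move: h; lra.
Qed.

(** With [f] the numbers of children, [prod_i (1 + u (f i - 1))] is at most
    [exp (- s sum_i h (f i))], since [sum_i (f i - 1) = -1]. The sum of the
    [h (f i)] is a sum of bounded independent variables before conditioning, so
    that its exponential moment controls the conditional one, up to the
    subexponential price of conditioning. *)
Lemma mixpoly_exp_le (u s l B : R) (h : nat -> R) n :
  0 <= u <= 1 -> 0 <= s <= l -> (0 < n)%N ->
  (forall c, 1 + u * (c%:R - 1) <= expR (u * (c%:R - 1) - s * h c)) ->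
  (mixpoly u n.+1 ^+ n)`_n.-1 <=
  expR (- (s * B)) * (convpow p n n.-1 +
    expR (l * B) * (\sum_(c < n.+1) p c * expR (- (l * h c))) ^+ n).
Proof.
move=> /andP[u0 u1] sl n0 hP.
pose H (f : {ffun 'I_n -> 'I_n.+1}) := \sum_(i < n) h (f i).
have expH x (f : {ffun 'I_n -> 'I_n.+1}) : \prod_(i < n) (p (f i) * expR (- (x * h (f i)))) =
    (\prod_(i < n) p (f i)) * expR (- (x * H f)).
  rewrite big_split/=; congr (_ * _).
  by rewrite -expR_sum sumrN -mulr_sumr.
have -> : convpow p n n.-1 = (genpoly p n.+1 ^+ n)`_n.-1.
  by rewrite convpowE//; lia.
apply: (@le_trans _ _ (\sum_(f : {ffun 'I_n -> 'I_n.+1} | (\sum_(i < n) f i == n.-1)%N)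
   (\prod_(i < n) p (f i)) * expR (- (s * H f)))).
  rewrite coef_poly_exp; apply: ler_sum => f /eqP fs.
  apply: (@le_trans _ _ (\prod_(i < n) (p (f i) * expR (u * ((f i)%:R - 1) - s * h (f i))))).
    apply: ler_prod => i _; apply/andP; split; last by rewrite ler_wpM2l.
    rewrite mulr_ge0//; have : u * (f i)%:R >= 0 by rewrite mulr_ge0.
    lra.
  rewrite big_split/=; apply: ler_wpM2l; first exact: prodr_ge0.
  rewrite -expR_sum ler_expR sumrB -mulr_sumr -mulr_sumr lerBlDr addrC subrr.
  rewrite sumrB -natr_sum fs sumr_const card_ord.
  by rewrite mulr_ge0_le0// subr_le0 ler_nat leq_pred.
apply: (@le_trans _ _ (\sum_(f : {ffun 'I_n -> 'I_n.+1} | (\sum_(i < n) f i == n.-1)%N)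
   (expR (- (s * B)) * (\prod_(i < n) p (f i) + expR (l * B) *
      \prod_(i < n) (p (f i) * expR (- (l * h (f i)))))))).
  apply: ler_sum => f _; rewrite expH.
  have P0 : 0 <= \prod_(i < n) p (f i) by exact: prodr_ge0.
  apply: (le_trans (ler_wpM2l P0 (exp_mix_le B (H f) sl))).
  by rewrite le_eqVlt; apply/orP; left; apply/eqP; ring.
rewrite -mulr_sumr; apply: ler_wpM2l; first exact: expR_ge0.
rewrite big_split/= coef_poly_exp lerD2l -mulr_sumr.
apply: ler_wpM2l; first exact: expR_ge0.
have -> : (\sum_(c < n.+1) p c * expR (- (l * h c))) ^+ n =
    \sum_(f : {ffun 'I_n -> 'I_n.+1}) \prod_(i < n) (p (f i) * expR (- (l * h (f i)))).
  by rewrite -[X in _ ^+ X](card_ord n) -prodr_const bigA_distr_bigA/=.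
rewrite [leLHS]big_mkcond/=. apply: ler_sum => f _; case: ifP => // _.
by apply: prodr_ge0 => i _; rewrite mulr_ge0// expR_ge0.
Qed.

(** The truncation at [M] keeps this bounded, while its mean still grows without
    bound with [M]. *)
Definition sqexcess (M c : nat) : R :=
  if (1 < c <= M)%N then (c%:R - 1) ^+ 2 else 0.

Lemma sqexcess_le M c : 0 <= sqexcess M c <= M.+1%:R ^+ 2.
Proof.
rewrite /sqexcess; case: ifP => [/andP[c1 cM]|_]; last by rewrite lexx exprn_ge0.
have c1' : 0 <= c%:R - 1 :> R by rewrite subr_ge0 ler1n ltnW.
rewrite sqr_ge0/=; apply: lerXn2r; rewrite ?nnegrE//.
by rewrite lerBlDr natr1 ler_nat (leq_trans cM)// -addn2 leq_addr.
Qed.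

Lemma sqexcess_large (A : R) : exists M, forall N, (M < N)%N ->
  A <= \sum_(c < N) p c * sqexcess M c.
Proof.
have [M MP] := var_oo (4 * A + 4); exists M => N MN.
have le1 c : (c < M)%N -> c%:R ^+ 2 * p c <= 4 * (p c * sqexcess M c) + 4 * p c.
  rewrite /sqexcess => cM; case: c cM => [|[|c]] cM.
  - by rewrite expr0n mul0r mulr0 mulr0 add0r mulr_ge0.
  - by rewrite expr1n mul1r mulr0 mulr0 add0r; have := p_ge0 1; lra.
  rewrite (ltnW cM)/= -[c.+2%:R]natr1 addrK.
  move: (c.+1%:R : R) (p c.+2) (p_ge0 c.+2) => x q q0.
  have := mulr_ge0 q0 (sqr_ge0 (x - 1)); have := mulr_ge0 q0 (sqr_ge0 x); lra.
have : \sum_(c < M) c%:R ^+ 2 * p c <=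
    4 * (\sum_(c < M) p c * sqexcess M c) + 4 * \sum_(c < M) p c.
  by rewrite !mulr_sumr -big_split/=; apply: ler_sum => c _; exact: le1.
have : \sum_(c < M) p c * sqexcess M c <= \sum_(c < N) p c * sqexcess M c.
  rewrite (big_ord_widen N (fun c => p c * sqexcess M c) (ltnW MN)).
  rewrite big_mkcond; apply: ler_sum => c _; case: ifP => // _.
  by rewrite mulr_ge0//; case/andP: (sqexcess_le M c).
have := mass_le1 M; lra.
Qed.

(** Divided by the probability of the condition, the left-hand side is the
    probability that a uniform node of the tree of size [n] has height at least
    [k]. It decays like [exp (- A k^2 / n)] with an arbitrarily large [A]:
    the sum of the truncated squared excesses is of order [n] times their mean,
    which grows without bound with [M]. *)
Lemma spine_sum_tail (A : R) : 0 < A -> exists e : R, 0 < e <= 1 /\ exists n0,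
  forall n k, (n0 <= n)%N -> 0 < convpow p n n.-1 -> k%:R <= e * n%:R ->
  spine_sum n k <= 4 * expR (- (A * k%:R ^+ 2 / n%:R)) * convpow p n n.-1.
Proof.
move=> A0; have [M MP] := sqexcess_large (128 * A).
pose e : R := M.+1%:R^-1; pose l : R := (M.+1%:R ^+ 2)^-1.
have M1 : 0 < M.+1%:R :> R by rewrite ltr0n.
have e0 : 0 < e by rewrite invr_gt0.
have e1 : e <= 1 by rewrite invf_le1// ler1n.
have lE : l = e ^+ 2 by rewrite /l exprVn.
have l0 : 0 < l by rewrite lE exprn_gt0.
have d0 : 0 < l * (32 * A) by rewrite mulr_gt0// mulr_gt0.
have [n0 n0P] := convpow_subexponential p_ge0 mass_le1 mass1 mean_le1 var_oo d0.
(* [k <= e n] makes [u = k / (2 n)] so small that [u (c - 1) <= 1 / 2] whenever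
   [c <= M] and that the rate [u ^ 2 / 8] is below [l] *)
exists e; split; first by rewrite e0.
exists (maxn n0 M.+1) => n k; rewrite geq_max => /andP[n0n Mn] np ken.
have n_gt0 : (0 < n)%N by apply: leq_ltn_trans Mn.
have nR0 : 0 < n%:R :> R by rewrite ltr0n.
have kn : (k <= n)%N.
  by rewrite -(ler_nat R) (le_trans ken)// ler_piMl.
pose u : R := k%:R / 2 / n%:R.
have u0 : 0 <= u by rewrite /u !divr_ge0.
have ue : u <= e / 2 by rewrite /u ler_pdivrMr//; lra.
have u01 : 0 <= u <= 1 by rewrite u0/=; lra.
pose s : R := u ^+ 2 / 8; pose B : R := 32 * A * n%:R.
have sl : 0 <= s <= l.
  rewrite /s divr_ge0 ?sqr_ge0//= lE.
  have : u ^+ 2 <= (e / 2) ^+ 2 by apply: lerXn2r; rewrite ?nnegrE//; lra.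
  by have := sqr_ge0 e; nra.
have hP c : 1 + u * (c%:R - 1) <= expR (u * (c%:R - 1) - s * sqexcess M c).
  rewrite /sqexcess; case: ifP => [/andP[c1 cM]|_]; last first.
    by rewrite mulr0 subr0 expR_ge1Dx.
  have c1' : 0 <= c%:R - 1 :> R by rewrite subr_ge0 ler1n ltnW.
  have -> : s * (c%:R - 1) ^+ 2 = (u * (c%:R - 1)) ^+ 2 / 8 by rewrite /s; field.
  apply: expR_ge1_sqr; rewrite mulr_ge0//=.
  apply: (@le_trans _ _ (e / 2 * M.+1%:R)).
    apply: ler_pM => //; rewrite lerBlDr natr1 ler_nat.
    by rewrite (leq_trans cM)// -addn2 leq_addr.
  by rewrite /e mulrAC mulVf ?mul1r// gt_eqF.
apply: le_trans (spine_sum_le_mix u01 n_gt0 kn _) _.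
  by rewrite /u mulrCA mulfV ?mulr1// gt_eqF.
have := mixpoly_exp_le B u01 sl n_gt0 hP.
have -> : s * B = A * k%:R ^+ 2 / n%:R.
  by rewrite /s /B /u; field; rewrite gt_eqF.
(* the mean of the truncated excess is at least [128 A], so the level [B] is a
   quarter of what is typical before conditioning, and the price of conditioning
   is absorbed by the exponential moment *)
suff chernoff : expR (l * B) * (\sum_(c < n.+1) p c * expR (- (l * sqexcess M c))) ^+ n
    <= convpow p n n.-1.
  set E := expR _ => h.
  have : E * (convpow p n n.-1 + expR (l * B) *
      (\sum_(c < n.+1) p c * expR (- (l * sqexcess M c))) ^+ n) <=
    E * (2 * convpow p n n.-1).
    by rewrite ler_wpM2l ?expR_ge0//; lra.
  by move: h; lra.
apply: le_trans (n0P n n0n np).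
have : \sum_(c < n.+1) p c * expR (- (l * sqexcess M c)) <= expR (- (l * (64 * A))).
  apply: (@le_trans _ _ (\sum_(c < n.+1) p c * (1 - l * sqexcess M c / 2))).
    apply: ler_sum => c _; rewrite ler_wpM2l//; apply: expRN_le.
    case/andP: (sqexcess_le M c) => h0 h1; rewrite mulr_ge0 ?(ltW l0)//=.
    by rewrite /l mulrC ler_pdivrMr ?exprn_gt0// mul1r.
  under eq_bigr do rewrite mulrBr mulr1.
  rewrite sumrB; apply: le_trans (expR_ge1Dx _).
  have := mass_le1 n.+1; have := MP n.+1 (leqW Mn) => h1 h2.
  have -> : \sum_(i < n.+1) p i * (l * sqexcess M i / 2) =
     l * (\sum_(c < n.+1) p c * sqexcess M c) / 2.
    by rewrite mulr_sumr mulr_suml; apply: eq_bigr => i _; ring.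
  by have := ler_wpM2l (ltW l0) h1; lra.
move=> h.
apply: (@le_trans _ _ (expR (l * B) * expR (- (l * (64 * A))) ^+ n)).
  rewrite ler_wpM2l ?expR_ge0//; apply: lerXn2r; rewrite ?nnegrE ?expR_ge0//.
  by apply: sumr_ge0 => c _; rewrite mulr_ge0 ?expR_ge0.
rewrite -expRM_natl -expRD ler_expR /B le_eqVlt; apply/orP; left; apply/eqP.
by ring.
Qed.

End DepthTail.

(** * Mean depth, height and width *)

Definition trees (n : nat) : seq plane_tree := [seq head leaf f | f <- forests n 1].

Lemma forests1 n f : f \in forests n 1 -> f = [:: head leaf f].
Proof. by rewrite mem_forests => /andP[]; case: f => [|t []]. Qed.

Lemma mem_trees n t : (t \in trees n) = (tree_size t == n).
Proof.
apply/mapP/eqP => [[f fF ->]|tn]; last first.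
  by exists [:: t]; rewrite // mem_forests /forest_size /= addn0 tn !eqxx.
move: (fF); rewrite (forests1 fF) mem_forests => /andP[_ /eqP].
by rewrite /forest_size /= addn0.
Qed.

Lemma uniq_trees n : uniq (trees n).
Proof.
rewrite map_inj_in_uniq ?uniq_forests// => f g /forests1 -> /forests1 ->.
by move=> /= ->.
Qed.

Lemma size_node t u : u \in nodes t -> (size u < tree_size t)%N.
Proof.
elim/plane_tree_induction: t u => ts IH [|i u]; rewrite tree_size_Node//.
rewrite cons_nodes ltnS => /andP[lti /(IH _ lti)/leq_trans]; apply.
rewrite /forest_size sumnE big_map (big_nth leaf) big_mkord.
by rewrite (bigD1 (Ordinal lti))//= leq_addr.
Qed.

Lemma size_node_ht t u : u \in nodes t -> (size u <= ht t)%N.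
Proof. by move=> ut; rewrite /ht (big_rem u)//= leq_maxl. Qed.

Definition depth_sum (t : plane_tree) : nat := (\sum_(u <- nodes t) size u)%N.

Lemma depth_sum_nb_above t :
  depth_sum t = (\sum_(k < tree_size t) nb_above k.+1 t)%N.
Proof.
under eq_bigr do rewrite /nb_above -sum1_count big_mkcond/=.
rewrite exchange_big/= /depth_sum big_seq [RHS]big_seq.
apply: eq_bigr => u /size_node ut; rewrite -big_mkcond/=.
by rewrite -(big_ord_widen _ (fun=> 1%N) (ltnW ut)) sum1_card card_ord.
Qed.

Lemma ht_le_nb_above K t : (ht t <= K + tree_size t * nb_above K t)%N.
Proof.
apply/bigmax_leqP_seq => u ut _; have [uK|Ku] := leqP (size u) K.
  exact: leq_trans uK (leq_addr _ _).
rewrite (leq_trans (ltnW (size_node ut)))// (leq_trans _ (leq_addl _ _))//.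
rewrite leq_pmulr// /nb_above -has_count; apply/hasP; exists u => //.
exact: ltnW.
Qed.

Lemma count_level_le_wid k t : (count (fun u => size u == k) (nodes t) <= wid t)%N.
Proof.
have [kh|hk] := leqP k (ht t).
  by rewrite /wid (bigD1 (Ordinal (kh : k < (ht t).+1)%N))//= leq_maxl.
rewrite (_ : count _ _ = 0)%N//; apply/eqP; rewrite -leqn0 leqNgt -has_count.
apply/hasP => -[u /size_node_ht uh /eqP uk].
by rewrite uk leqNgt hk in uh.
Qed.

(** A narrow tree is high at most of its nodes: less than [k] times the width
    many nodes have height less than [k]. *)
Lemma depth_sum_wid k t :
  (k * tree_size t <= depth_sum t + k * (k * wid t))%N.
Proof.
have low : (count (fun u => size u < k)%N (nodes t) <= k * wid t)%N.
  elim: k => [|k IH]; first by rewrite (eq_count (a2 := pred0)) ?count_pred0.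
  rewrite (eq_count (a2 := predU (fun u => size u < k)%N (fun u => size u == k))).
    rewrite -[leqLHS](addnK (count (predI (fun u => size u < k)%N
       (fun u => size u == k)) (nodes t))) count_predUI.
    by rewrite (leq_trans (leq_subr _ _))// mulSn addnC leq_add// count_level_le_wid.
  by move=> u /=; rewrite ltnS leq_eqVlt orbC.
have -> : (k * tree_size t = \sum_(u <- nodes t) k)%N.
  by rewrite big_const_seq iter_addn_0 count_predT.
apply: (@leq_trans (\sum_(u <- nodes t) (size u + (size u < k)%N * k))%N).
  by apply: leq_sum => u _; case: ltnP => uk; rewrite ?mul1n ?mul0n ?addn0 ?leq_addl.
rewrite big_split leq_add2l -big_distrl/= mulnC leq_mul2l.
apply/orP; right; apply: leq_trans low; rewrite -sum1_count [leqRHS]big_mkcond.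
by apply: leq_sum => u _; case: ifP.
Qed.

Lemma sqrt_large (R : realType) (x : R) :
  exists n0, forall n, (n0 <= n)%N -> x <= Num.sqrt n%:R.
Proof.
have [m mP] := archi_nat (Num.max 0 x ^+ 2); exists m => n mn.
have y0 : 0 <= Num.max 0 x by rewrite le_max lexx.
apply: (@le_trans _ _ (Num.max 0 x)); first by rewrite le_max lexx orbT.
rewrite -[leLHS](ger0_norm y0) -sqrtr_sqr ler_wsqrtr// (le_trans mP)//.
by rewrite ler_nat.
Qed.

Lemma ln_large (R : realType) (x : R) :
  exists n0, forall n, (n0 <= n)%N -> x <= ln n%:R.
Proof.
have [m mP] := archi_nat (expR x); exists m => n mn.
have xn : expR x <= n%:R by rewrite (le_trans mP)// ler_nat.
by rewrite -[leLHS]expRK ler_ln ?posrE ?expR_gt0// (lt_le_trans (expR_gt0 x)).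
Qed.

Section Averages.
Context (R : realType) (p : nat -> R).
Hypothesis p_ge0 : forall c, 0 <= p c.
Hypothesis mass_le1 : forall N, \sum_(c < N) p c <= 1.
Hypothesis mass1 : forall e : R, 0 < e -> exists N, 1 - e <= \sum_(c < N) p c.
Hypothesis mean_le1 : forall N, \sum_(c < N) c%:R * p c <= 1.
Hypothesis var_oo : forall K : R, exists N, K <= \sum_(c < N) c%:R ^+ 2 * p c.

(** For an offspring distribution [p], the probability that the family tree has
    [n] nodes. *)
Definition size_weight (n : nat) : R := \sum_(t <- trees n) weight p t.

Lemma spine_sum_trees n k : (0 < n)%N -> (k <= n)%N ->
  spine_sum p n k = \sum_(t <- trees n) weight p t * (nb_above k t)%:R.
Proof.
move=> n0 kn; rewrite spine_sum_nb_above// big_map big_seq [RHS]big_seq.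
apply: eq_bigr => f /forests1 fE; rewrite {1}fE.
by rewrite /forest_weight big_seq1.
Qed.

Lemma convpow_size_weight n : (0 < n)%N ->
  convpow p n n.-1 = n%:R * size_weight n.
Proof.
move=> n0; rewrite -spine_sum0// spine_sum_trees// mulr_sumr big_seq [RHS]big_seq.
by apply: eq_bigr => t; rewrite mem_trees nb_above0 mulrC => /eqP->.
Qed.


(** Below a small multiple of [sqrt n] the tail is bounded
    by 1, and beyond it by a small multiple of [n / k ^ 2]. *)
Lemma sum_depth_small (e : R) : 0 < e -> exists n0, forall n, (n0 <= n)%N ->
  0 < size_weight n ->
  \sum_(t <- trees n) weight p t * (depth_sum t)%:R <=
  e * Num.sqrt n%:R * n%:R * size_weight n.
Proof.
move=> e0; have [A AE] : exists A, A = 64 / e ^+ 2 by exists (64 / e ^+ 2).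
have A0 : 0 < A by rewrite AE divr_gt0// exprn_gt0.
have [c [/andP[c0 c1] [n0 tailP]]] := spine_sum_tail p_ge0 mass_le1 mass1 mean_le1 var_oo A0.
have [n1 n1P] := sqrt_large (4 / e).
have [n2 n2P] := archi_nat (2 / c).
have [n3 n3P] := sqrt_large (64 / (A * c ^+ 2 * e)).
exists (maxn (maxn n0 n1) (maxn n2.+1 n3)) => n.
rewrite !geq_max => /andP[/andP[n0n /n1P sn1] /andP[n2n /n3P sn3]] wn.
have n_gt0 : (0 < n)%N by apply: leq_ltn_trans n2n.
have nR0 : 0 < n%:R :> R by rewrite ltr0n.
have s0 : 0 < Num.sqrt n%:R :> R by rewrite sqrtr_gt0.
have sE : Num.sqrt n%:R ^+ 2 = n%:R :> R by rewrite sqr_sqrtr.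
set C := convpow p n n.-1.
have CE : C = n%:R * size_weight n := convpow_size_weight n_gt0.
have C0 : 0 < C by rewrite CE mulr_gt0.
have -> : \sum_(t <- trees n) weight p t * (depth_sum t)%:R =
    \sum_(k < n) spine_sum p n k.+1.
  rewrite (eq_bigr (fun k : 'I_n => \sum_(t <- trees n)
     weight p t * (nb_above k.+1 t)%:R)); last first.
    by move=> k _; rewrite spine_sum_trees.
  rewrite exchange_big/= big_seq [RHS]big_seq; apply: eq_bigr => t.
  rewrite mem_trees => /eqP tn.
  by rewrite depth_sum_nb_above tn natr_sum mulr_sumr.
have C1 k : (k <= n)%N -> spine_sum p n k <= C.
  by move=> kn; rewrite /C -spine_sum0//; apply: spine_sum_mono; rewrite ?kn.
have expN_le (x : R) : 0 < x -> expR (- x) <= x^-1.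
  move=> x0; rewrite expRN lef_pV2 ?posrE ?expR_gt0//.
  by have := expR_ge1Dx x; lra.
have small k : (0 < k)%N -> k%:R <= c * n%:R ->
    spine_sum p n k <= 4 * n%:R / A * (k%:R ^+ 2)^-1 * C.
  move=> k0 kc; apply: le_trans (tailP n k n0n C0 kc) _.
  rewrite ler_wpM2r ?(ltW C0)// -!mulrA ler_wpM2l//.
  have kR0 : 0 < k%:R :> R by rewrite ltr0n.
  apply: le_trans (expN_le _ _) _; first by rewrite !mulr_gt0 ?invr_gt0 ?exprn_gt0.
  rewrite le_eqVlt; apply/orP; left; apply/eqP; field.
  by rewrite !gt_eqF.
(* the last index at which the Gaussian bound applies *)
pose k0 := Num.truncn (c * n%:R).
have cn0 : 0 <= c * n%:R by rewrite mulr_ge0 ?(ltW c0).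
have /andP[k0le k0gt] := truncn_itv cn0; rewrite -/k0 in k0le k0gt.
have cn2 : 2 <= c * n%:R.
  rewrite mulrC -ler_pdivrMr// (le_trans n2P)// ler_nat; exact: ltnW.
have k0half : c * n%:R / 2 <= k0%:R by rewrite -natr1 in k0gt; lra.
have k0n : (k0 <= n)%N by rewrite -(ler_nat R) (le_trans k0le)// ler_piMl.
have k0_gt0 : (0 < k0)%N by rewrite -(ltr_nat R); lra.
pose eta : R := 16 / (A * c ^+ 2 * n%:R).
have eta0 : 0 <= eta by rewrite divr_ge0// !mulr_ge0 ?exprn_ge0// ltW.
have large k : (k0 <= k <= n)%N -> spine_sum p n k <= eta * C.
  move=> kP; apply: (le_trans (spine_sum_mono p_ge0 n_gt0 kP)).
  apply: le_trans (small _ k0_gt0 k0le) _; rewrite ler_wpM2r ?(ltW C0)//.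
  apply: (@le_trans _ _ (4 * n%:R / A * ((c * n%:R / 2) ^+ 2)^-1)).
    rewrite ler_wpM2l ?divr_ge0 ?(ltW A0) ?mulr_ge0// lef_pV2 ?posrE ?exprn_gt0//.
    - by apply: lerXn2r; rewrite ?nnegrE// divr_ge0.
    - by rewrite ltr0n.
    - by rewrite divr_gt0// mulr_gt0.
  rewrite le_eqVlt; apply/orP; left; apply/eqP; rewrite /eta; field.
  by rewrite !gt_eqF.
pose x := e / 4 * Num.sqrt n%:R.
have x1 : 1 <= x.
  by move: sn1; rewrite ler_pdivrMr// /x; lra.
pose a := (Num.truncn x).+1.
have x0 : 0 <= x by lra.
have /andP[tx xt] := truncn_itv x0; rewrite -/a in xt.
have ax : a%:R <= 2 * x by rewrite /a -natr1; lra.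
pose g k := (if (k < a)%N then 1 else 4 * n%:R / A * (k.+1%:R ^+ 2)^-1) : R.
apply: (@le_trans _ _ (\sum_(k < n) (g k + eta) * C)).
  apply: ler_sum => k _; rewrite mulrDl.
  have [kk|kk] := leqP k.+1 k0; last first.
    apply: (le_trans (large _ _)); first by rewrite (ltnW kk) ltn_ord.
    rewrite lerDr mulr_ge0 ?(ltW C0)// /g; case: ifP => // _.
    by rewrite mulr_ge0 ?invr_ge0 ?divr_ge0 ?mulr_ge0 ?exprn_ge0// ltW.
  apply: (@le_trans _ _ (g k * C)); last by rewrite lerDl mulr_ge0// ltW.
  rewrite /g; case: ifP => ka; first by rewrite mul1r C1.
  by apply: small; rewrite // (le_trans _ k0le)// ler_nat.
rewrite -mulr_suml -[leRHS]mulrA -CE ler_wpM2r ?(ltW C0)// big_split/=.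
rewrite sumr_const card_ord -[eta *+ n]mulr_natr.
have -> : eta * n%:R = 16 / (A * c ^+ 2) by rewrite /eta; field; rewrite !gt_eqF.
have B1 : 16 / (A * c ^+ 2) <= e / 4 * Num.sqrt n%:R.
  rewrite (_ : 16 / (A * c ^+ 2) = e / 4 * (64 / (A * c ^+ 2 * e))); last first.
    by field; rewrite !gt_eqF.
  by rewrite ler_wpM2l// divr_ge0// ltW.
have B2 : \sum_(k < n) g k <= a%:R + 4 * n%:R / A * a%:R^-1.
  have [na|an] := leqP n a.
    apply: (@le_trans _ _ (\sum_(k < n) 1)).
      by apply: ler_sum => k _; rewrite /g (leq_trans (ltn_ord k)).
    rewrite sumr_const card_ord; apply: (@le_trans _ _ a%:R).
      by rewrite ler_nat.
    by rewrite lerDl !mulr_ge0 ?invr_ge0// ltW.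
  rewrite -(big_mkord xpredT g) (@big_cat_nat _ _ _ a) ?(ltnW an)//=.
  apply: lerD.
    rewrite big_mkord (eq_bigr (fun=> 1)) ?sumr_const ?card_ord// => k _.
    by rewrite /g ltn_ord.
  rewrite big_nat_cond (eq_bigr (fun k => 4 * n%:R / A * (k.+1%:R ^+ 2)^-1)); last first.
    by move=> k /andP[/andP[ak _] _]; rewrite /g ltnNge ak.
  rewrite -big_nat_cond -mulr_sumr ler_wpM2l ?divr_ge0 ?mulr_ge0 ?(ltW A0)//.
  apply: le_trans (sum_inv_sqr_tail _ _) _; first by rewrite (ltnW an).
  by rewrite gerBl invr_ge0.
have B3 : 4 * n%:R / A * a%:R^-1 <= x.
  apply: (@le_trans _ _ (4 * n%:R / A * x^-1)).
    rewrite ler_wpM2l ?divr_ge0 ?mulr_ge0 ?(ltW A0)// lef_pV2 ?posrE ?ltr0n//.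
      exact: ltW.
    by lra.
  rewrite -sE /x AE le_eqVlt; apply/orP; left; apply/eqP; field.
  by rewrite !gt_eqF.
have xE : e * Num.sqrt n%:R = 4 * x by rewrite /x; field.
by rewrite xE; move: B1; rewrite -/x; lra.
Qed.

(** If no node is above [K] then the height is at most [K], and otherwise it is
    at most [n], hence at most [n] times the number of these nodes. *)
Lemma sum_ht_small (e : R) : 0 < e -> exists n0, forall n, (n0 <= n)%N ->
  0 < size_weight n ->
  \sum_(t <- trees n) weight p t * (ht t)%:R <=
  e * (Num.sqrt n%:R * ln n%:R ^+ 3) * size_weight n.
Proof.
move=> e0.
have [c [/andP[c0 c1] [n0 tailP]]] := spine_sum_tail p_ge0 mass_le1 mass1 mean_le1 var_oo ltr01.
have [n1 n1P] := @ln_large R (2 + 32 / c + 6 / e).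
have [n2 n2P] := @sqrt_large R (2 / c + 1).
exists (maxn (maxn n0 n1) n2.+1) => n.
rewrite !geq_max => /andP[/andP[n0n /n1P ln1] n2n] wn.
have sn2 := n2P n (ltnW n2n).
have n_gt0 : (0 < n)%N by apply: leq_ltn_trans n2n.
have nR0 : 0 < n%:R :> R by rewrite ltr0n.
have sE : Num.sqrt n%:R ^+ 2 = n%:R :> R by rewrite sqr_sqrtr.
set s := Num.sqrt n%:R in sE sn2 *; set L := ln n%:R in ln1 *.
have ic0 : 0 < c^-1 by rewrite invr_gt0.
have ie0 : 0 < e^-1 by rewrite invr_gt0.
have L2 : 2 <= L by lra.
have s1 : 1 <= s by lra.
have C0 : 0 < convpow p n n.-1 by rewrite convpow_size_weight// mulr_gt0.
(* for [n = exp L], [sqrt n = exp (L / 2)] is at least quadratic in [L] *)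
have Ls : L <= c / 2 * s.
  have -> : s = expR (L / 2).
    apply: (@pexpIrn _ 2) => //; rewrite ?nnegrE ?expR_ge0//; first by lra.
    by rewrite sE -expRM_natl mulrC divfK// lnK.
  have h := @expR_ge_exprn R 1 (L / 2).
  apply: (@le_trans _ _ (c / 2 * (1 + L / 2 / 2) ^+ 2)); last first.
    by rewrite ler_wpM2l ?h//; lra.
  have : c * 32 / c <= c * L by rewrite -mulrA ler_wpM2l//; lra.
  by rewrite mulrAC mulfV ?mul1r ?gt_eqF//; nra.
have sL0 : 0 <= s * L by rewrite mulr_ge0//; lra.
(* at height [sqrt n log n] the tail [exp (- K ^ 2 / n)] beats [n ^ 2] *)
pose K := (Num.truncn (s * L)).+1.
have /andP[tK Kt] := truncn_itv sL0; rewrite -/K in Kt.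
have Kc : K%:R <= c * n%:R.
  rewrite /K -natr1.
  have : s * L <= s * (c / 2 * s) by rewrite ler_wpM2l//; lra.
  have : 1 <= c / 2 * s.
    have := ler_wpM2l (ltW c0) sn2.
    by rewrite mulrDr mulrCA mulfV ?gt_eqF//; lra.
  by rewrite -sE; nra.
have Kn : (K <= n)%N by rewrite -(ler_nat R) (le_trans Kc)// ler_piMl// ltW.
have tK4 : n%:R * spine_sum p n K <= 4 * size_weight n.
  have := tailP n K n0n C0 Kc; rewrite convpow_size_weight// mul1r => h.
  have : n%:R * (n%:R * expR (- (K%:R ^+ 2 / n%:R))) <= 1 :> R.
    have nE : expR L = n%:R by rewrite /L lnK ?posrE.
    rewrite -nE -!expRD -[leRHS]expR0 ler_expR.
    have : s ^+ 2 * L ^+ 2 <= K%:R ^+ 2 :> R.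
      by rewrite -exprMn; apply: lerXn2r; rewrite ?nnegrE// ltW.
    rewrite sE => hK.
    have : L ^+ 2 <= K%:R ^+ 2 / expR L by rewrite nE ler_pdivlMr// mulrC.
    have : 2 * L <= L ^+ 2 by rewrite expr2 ler_wpM2r//; lra.
    by move: (_ / _) => y; lra.
  have := ltW wn; move: h.
  set E := expR _; set W := size_weight n; set S := spine_sum _ _ _.
  move=> h W0 h1.
  have := ler_wpM2l (ltW nR0) h; have := ler_wpM2r W0 h1; lra.
apply: (@le_trans _ _ (\sum_(t <- trees n)
    weight p t * (K%:R + n%:R * (nb_above K t)%:R))).
  rewrite big_seq [leRHS]big_seq; apply: ler_sum => t; rewrite mem_trees => /eqP tn.
  rewrite ler_wpM2l ?weight_ge0// -natrM -natrD ler_nat -{1}tn.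
  exact: ht_le_nb_above.
under eq_bigr do rewrite mulrDr mulrCA.
rewrite big_split/= -mulr_suml -mulr_sumr -spine_sum_trees// -/(size_weight n).
apply: (@le_trans _ _ ((K%:R + 4) * size_weight n)).
  by rewrite mulrDl [size_weight n * _]mulrC lerD2l.
rewrite ler_wpM2r ?(ltW wn)//.
have : s * 2 <= s * L by rewrite ler_wpM2l//; lra.
have : 6 <= e * L ^+ 2.
  have : e * (6 / e) <= e * L by rewrite ler_wpM2l ?(ltW e0)//; lra.
  rewrite mulrCA mulfV ?gt_eqF// mulr1 => h6.
  by rewrite expr2 mulrA; nra.
move=> h6 h2.
have : 6 * (s * L) <= e * L ^+ 2 * (s * L) by rewrite ler_wpM2r.
rewrite (_ : e * L ^+ 2 * (s * L) = e * (s * L ^+ 3)); last by ring.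
by move: tK; rewrite /K -natr1; lra.
Qed.

(** Markov's inequality for the mean depth, which is large for narrow trees. *)
Lemma sum_narrow_small (K e : R) : 0 < e -> exists n0, forall n, (n0 <= n)%N ->
  0 < size_weight n ->
  \sum_(t <- trees n | (wid t)%:R < K * Num.sqrt n%:R) weight p t <=
  e * size_weight n.
Proof.
move=> e0; have [K' K0 KK'] : exists2 K' : R, 0 < K' & K <= K'.
  by exists (Num.max K 1); rewrite ?lt_max ?le_max ?ltr01 ?lexx ?orbT.
have [n0 n0P] := sum_depth_small (divr_gt0 e0 (mulr_gt0 (ltr0n _ 8) K0)).
have [n1 n1P] := @sqrt_large R (4 * K').
exists (maxn n0 n1.+1) => n; rewrite geq_max => /andP[n0n n1n] wn.
have sn := n1P n (ltnW n1n).
have n_gt0 : (0 < n)%N by apply: leq_ltn_trans n1n.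
have nR0 : 0 < n%:R :> R by rewrite ltr0n.
have sE : Num.sqrt n%:R ^+ 2 = n%:R :> R by rewrite sqr_sqrtr.
have := n0P n n0n wn; set s := Num.sqrt n%:R in sE sn *.
have s0 : 0 < s by rewrite sqrtr_gt0.
have x0 : 0 <= s / (2 * K') by rewrite divr_ge0 ?mulr_ge0// ltW.
pose k := Num.truncn (s / (2 * K')).
have /andP[kle kgt] := truncn_itv x0; rewrite -/k in kle kgt.
have kK : k%:R * (2 * K') <= s by rewrite -ler_pdivlMr// mulr_gt0.
have kbig : s / (4 * K') <= k%:R.
  have : 1 <= s / (4 * K') by rewrite ler_pdivlMr ?mulr_gt0// mul1r.
  have : s / (2 * K') = 2 * (s / (4 * K')) by field; rewrite gt_eqF.
  move: kgt; rewrite -[k.+1%:R]natr1; move: (s / (2 * K')) (s / (4 * K')) => y z; lra.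
have k0 : 0 < k%:R :> R by apply: lt_le_trans kbig; rewrite divr_gt0// mulr_gt0.
have narrow t : tree_size t = n -> (wid t)%:R < K * s ->
    k%:R * n%:R / 2 <= (depth_sum t)%:R :> R.
  move=> tn wt; have := depth_sum_wid k t; rewrite tn -(ler_nat R) natrD !natrM.
  have : k%:R * (k%:R * (wid t)%:R) <= k%:R * (n%:R / 2) :> R.
    rewrite ler_wpM2l// -sE; apply: (@le_trans _ _ (k%:R * (K' * s))).
      rewrite ler_wpM2l//; apply: le_trans (ltW wt) _.
      by rewrite ler_wpM2r ?(ltW s0).
    have := ler_wpM2r (ltW s0) kK; lra.
  by lra.
move=> h.
have : \sum_(t <- trees n | (wid t)%:R < K * s) weight p t * (k%:R * n%:R / 2) <=
    \sum_(t <- trees n) weight p t * (depth_sum t)%:R.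
  rewrite big_mkcond big_seq [leRHS]big_seq; apply: ler_sum => t.
  rewrite mem_trees => /eqP tn; have w0 := weight_ge0 p_ge0 t.
  by case: ifPn => [wt|_]; [rewrite ler_wpM2l// narrow | rewrite mulr_ge0].
rewrite -mulr_suml; set S := \sum_(_ <- _ | _) _.
have S0 : 0 <= S by apply: sumr_ge0 => t _; exact: weight_ge0.
move=> /le_trans/(_ h) h1.
have h2 : S * (s / (4 * K') * n%:R / 2) <= S * (k%:R * n%:R / 2).
  by rewrite ler_wpM2l// ler_wpM2r// ler_wpM2r// ltW.
have := le_trans h2 h1.
have y0 : 0 < s / (4 * K') * n%:R / 2 by rewrite divr_gt0// mulr_gt0// divr_gt0// mulr_gt0.
rewrite -ler_pdivlMr// => /le_trans; apply.
rewrite le_eqVlt; apply/orP; left; apply/eqP; field.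
by rewrite !gt_eqF.
Qed.

End Averages.

(** * From weights to probabilities *)

Section Offspring.
Context (R : realType) (mu : probability nat R).

Definition pmf (c : nat) : R := fine (mu [set c]).

Lemma pmfE c : mu [set c] = (pmf c)%:E.
Proof. by rewrite /pmf fineK// fin_num_measure. Qed.

Lemma pmf_ge0 c : 0 <= pmf c.
Proof. exact: fine_ge0. Qed.

Lemma partial_sum_le (f : nat -> R) (x : R) N : (forall c, 0 <= f c) ->
  (\sum_(0 <= c <oo) (f c)%:E <= x%:E)%E -> \sum_(c < N) f c <= x.
Proof.
move=> f0 fx; rewrite -lee_fin; apply: le_trans fx.
rewrite -sumEFin -(big_mkord xpredT (fun c => (f c)%:E)).
by apply: nneseries_lim_ge => c _ _; rewrite lee_fin.
Qed.

Lemma partial_sum_ge (f : nat -> R) (x : R) : (forall c, 0 <= f c) ->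
  (x%:E < \sum_(0 <= c <oo) (f c)%:E)%E -> exists N, x <= \sum_(c < N) f c.
Proof.
move=> f0 xf; apply: contrapT => nex; move: xf; apply/negP; rewrite -leNgt.
apply: lime_le; first by apply: is_cvg_nneseries => c _ _; rewrite lee_fin.
apply: nearW => N; rewrite big_mkord sumEFin lee_fin leNgt; apply/negP => h.
by apply: nex; exists N; exact: ltW.
Qed.

Lemma pmf_total : (\sum_(0 <= c <oo) (pmf c)%:E = 1)%E.
Proof.
rewrite -(@probability_setT _ _ _ mu) (_ : setT = \bigcup_(c : nat) [set c]).
  rewrite measure_bigcup//; last by move=> i j _ _ [x [/= <- <-]].
  rewrite [RHS](@eq_eseriesl _ _ xpredT) => [|c]; last by rewrite in_setT.
  by apply: eq_eseriesr => c _; exact: esym (pmfE c).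
by apply/seteqP; split => // c _; exists c.
Qed.

Lemma pmf_mass_le1 N : \sum_(c < N) pmf c <= 1.
Proof. by apply: partial_sum_le; [exact: pmf_ge0 | rewrite pmf_total]. Qed.

Lemma pmf_mass1 (e : R) : 0 < e -> exists N, 1 - e <= \sum_(c < N) pmf c.
Proof.
move=> e0; apply: partial_sum_ge; first exact: pmf_ge0.
by rewrite pmf_total lte_fin; lra.
Qed.

Lemma pmf_mean_le1 : (pnorm mu 1 <= 1)%E ->
  forall N, \sum_(c < N) c%:R * pmf c <= 1.
Proof.
rewrite /pnorm invr1 poweRe1; last first.
  by apply: nneseries_ge0 => c _ _; rewrite mule_ge0// lee_fin powR_ge0.
move=> h N; apply: (@partial_sum_le (fun c => c%:R * pmf c)).
  by move=> c; rewrite mulr_ge0// pmf_ge0.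
apply: le_trans h; rewrite le_eqVlt; apply/orP; left; apply/eqP.
by apply: eq_eseriesr => c _; rewrite EFinM pmfE powRr1.
Qed.

Lemma pmf_var_oo : pnorm mu 2 = +oo%E ->
  forall K : R, exists N, K <= \sum_(c < N) c%:R ^+ 2 * pmf c.
Proof.
move=> /poweR_eqy h K; apply: (@partial_sum_ge (fun c => c%:R ^+ 2 * pmf c)).
  by move=> c; rewrite mulr_ge0 ?exprn_ge0// pmf_ge0.
rewrite (_ : (\sum_(0 <= c <oo) _)%E = +oo%E) ?ltry// -h.
by apply: eq_eseriesr => c _; rewrite EFinM pmfE powR_mulrn.
Qed.

End Offspring.

Section Branching.
Context (R : realType) (d : measure_display) (Omega : measurableType d).
Context (P : probability Omega R) (xi : seq nat -> {RV P >-> nat}).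
Context (mu : probability nat R) (hxi : branching_process xi mu).

Lemma bienayme_isE t : bienayme_is xi t =
  \bigcap_(u in [set` nodes t]) (xi u @^-1` [set nchild t u]).
Proof.
apply/seteqP; split => w /=; rewrite /bienayme_is/=.
  by move=> /family_tree_eqP h u /= ut; rewrite /= h.
by move=> h; apply/family_tree_eqP => u ut; exact: h.
Qed.

Lemma measurable_bienayme_is t : measurable (bienayme_is xi t).
Proof.
rewrite bienayme_isE; apply: fin_bigcap_measurable => // u _.
exact: measurable_funPTI.
Qed.

Lemma prob_bienayme_is t : P (bienayme_is xi t) = (weight (pmf mu) t)%:E.
Proof.
have -> : bienayme_is xi t =
    [set w | forall u, u \in nodes t -> [set nchild t u] (xi u w)].
  by rewrite bienayme_isE; apply/seteqP; split.
rewrite (hxi.1 (nodes t) (fun u => [set nchild t u]) (uniq_nodes t)).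
rewrite /weight -prodEFin; apply: eq_bigr => u _.
by rewrite -pmfE -(hxi.2 u).
Qed.

Lemma bienayme_has_sizeE n : bienayme_has_size xi n =
  \bigcup_(t in [set` trees n]) bienayme_is xi t.
Proof.
apply/seteqP; split => w /= [t].
  by move=> tn wt; exists t; rewrite //= mem_trees tn.
by rewrite /= mem_trees => /eqP tn wt; exists t.
Qed.

Lemma prob_bienayme_has_size n :
  P (bienayme_has_size xi n) = (size_weight (pmf mu) n)%:E.
Proof.
have fin : finite_set [set` trees n] by exact: finite_seq.
rewrite bienayme_has_sizeE measure_fin_bigcup//.
- rewrite fsbig_finite//= /size_weight -sumEFin.
  rewrite (perm_big (trees n)); last first.
    apply: uniq_perm; rewrite ?uniq_trees ?finmap.fset_uniq// => t.
    by rewrite in_fset_set//; exact: asboolb.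
  by apply: eq_bigr => t _; rewrite prob_bienayme_is.
- move=> t t' _ _ [w [/= wt wt']]; apply: nodes_inj.
  by rewrite -wt -wt'.
by move=> t _; exact: measurable_bienayme_is.
Qed.

Lemma prob_conditioned_bienayme n (d' : measure_display)
    (Omega' : measurableType d') (P' : probability Omega' R)
    (T : Omega' -> plane_tree) t :
  conditioned_bienayme xi n P' T -> t \in trees n ->
  P' [set w | T w = t] = (weight (pmf mu) t / size_weight (pmf mu) n)%:E.
Proof.
move=> [_ Tlaw] tn; rewrite Tlaw; last by apply/eqP; rewrite -mem_trees.
rewrite /cond_prob (_ : _ `&` _ = bienayme_is xi t).
  by rewrite prob_bienayme_is prob_bienayme_has_size.
by apply: setIidl; rewrite bienayme_has_sizeE => w wt; exists t.
Qed.

End Branching.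

Section Partition.
Context (R : realType) (d : measure_display) (Omega : measurableType d).
Context (P : probability Omega R).

(** Events that do not cover the whole space suffice, as long as their
    probabilities sum to 1: this allows a random tree to misbehave on a null
    set. *)
Lemma expectation_partition (I : eqType) (s : seq I) (B : I -> set Omega)
    (b x : I -> R) (X : Omega -> R) :
  uniq s -> (forall i, measurable (B i)) -> trivIset [set` s] B ->
  {in s, forall i, P (B i) = (b i)%:E} -> \sum_(i <- s) b i = 1 ->
  measurable_fun setT X -> (forall w, 0 <= X w) ->
  {in s, forall i, {in B i, forall w, X w = x i}} ->
  ('E_P[X] = (\sum_(i <- s) b i * x i)%:E)%E.
Proof.
move=> us mB tB PB b1 mX X0 XB; rewrite unlock.
pose D := \big[setU/set0]_(i <- s) B i.
have mD : measurable D by exact: bigsetU_measurable.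
have mXe : measurable_fun setT (EFin \o X) by exact/measurable_EFinP.
have indicB i : i \in s -> (\int[P]_(w in B i) (X w)%:E = (b i * x i)%:E)%E.
  move=> si; rewrite (eq_integral (fun=> (x i)%:E)).
    rewrite integral_cst// mulrC EFinM; congr (_ * _)%E; exact: PB.
  by move=> w wB; rewrite (XB i).
have PD : P D = 1%E.
  rewrite -[P D]mul1e -integral_cst// ge0_integral_bigsetU//=.
  transitivity (\sum_(i <- s) (b i)%:E)%E; last by rewrite sumEFin b1.
  rewrite big_seq [RHS]big_seq; apply: eq_bigr => i si; rewrite integral_cst//.
  by transitivity (P (B i)); [exact: mul1e | exact: PB].
rewrite (@ge0_negligible_integral _ _ _ _ _ (~` D))//.
- rewrite setTD setCK ge0_integral_bigsetU//.
  + rewrite -sumEFin big_seq [RHS]big_seq; apply: eq_bigr => i; exact: indicB.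
  + exact: measurable_funTS.
  + by move=> w _; rewrite lee_fin.
- exact: measurableC.
- by move=> w _; rewrite lee_fin.
by have := probability_setC P mD; rewrite PD subee.
Qed.

Lemma expectation_ge_prob (X : Omega -> R) (a : R) (A : set Omega) :
  measurable A -> measurable_fun setT X -> (forall w, 0 <= X w) -> 0 <= a ->
  (forall w, A w -> a <= X w) -> (a%:E * P A <= 'E_P[X])%E.
Proof.
move=> mA mX X0 a0 AX; rewrite -expectation_indic// unlock.
rewrite -ge0_integralZl//; last first.
  by apply/measurable_EFinP; exact: measurable_indic.
apply: ge0_le_integral => //.
- by move=> w _; rewrite mule_ge0// lee_fin.
- apply/measurable_EFinP/measurable_funM => //; exact: measurable_indic.
- exact/measurable_EFinP.
move=> w _; rewrite -EFinM lee_fin indicE.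
have [/set_mem wA|_] := boolP (w \in A); last by rewrite mulr0.
by rewrite mulr1 AX.
Qed.

Lemma discrete_measurable_comp (U : Type) (Y : Omega -> U) (g : U -> R) :
  discrete_measurable_fun Y -> measurable_fun setT (g \o Y).
Proof. by move=> mY _ A _; rewrite setTI comp_preimage; exact: mY. Qed.

End Partition.

(** * Convergence *)

Lemma cvge_fin_le (R : realType) (F : set_system nat) (a : R) (f : nat -> \bar R) :
  Filter F ->
  (forall e : R, 0 < e ->
     \forall n \near F, ((a - e)%:E <= f n <= (a + e)%:E)%E) ->
  f n @[n --> F] --> a%:E.
Proof.
move=> FF h; apply/fine_cvgP; split.
  apply: filterS (h 1 ltr01) => n /andP[h1 h2].
  by rewrite fin_real// (lt_le_trans (ltNyr _) h1) (le_lt_trans h2 (ltry _)).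
apply/cvgrPdist_le => e e0; apply: filterS (h e e0) => n /andP[h1 h2] /=.
have ffin : f n \is a fin_num.
  by rewrite fin_real// (lt_le_trans (ltNyr _) h1) (le_lt_trans h2 (ltry _)).
rewrite -(fineK ffin) !lee_fin in h1 h2.
by rewrite ler_norml; apply/andP; split; lra.
Qed.

Section ConditionedTree.
Context (R : realType) (mu : probability nat R) (d0 : measure_display)
  (Omega0 : measurableType d0) (P0 : probability Omega0 R)
  (xi : seq nat -> {RV P0 >-> nat}) (hxi : branching_process xi mu).
Context (n : nat) (d : measure_display) (Omega : measurableType d)
  (P : probability Omega R) (T : Omega -> plane_tree) (V : Omega -> seq nat).
Hypothesis hT : conditioned_bienayme xi n P T.
Hypothesis hV : uniform_node n P T V.
Hypothesis wn : 0 < size_weight (pmf mu) n.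

Let Z := size_weight (pmf mu) n.

Lemma expectation_tree (g : plane_tree -> R) : (forall t, 0 <= g t) ->
  ('E_P[g \o T] = ((\sum_(t <- trees n) weight (pmf mu) t * g t) / Z)%:E)%E.
Proof.
move=> g0.
rewrite (@expectation_partition _ _ _ P plane_tree (trees n)
  (fun t => [set w | T w = t]) (fun t => weight (pmf mu) t / Z) g).
- by rewrite mulr_suml; congr (_%:E); apply: eq_bigr => t _; rewrite mulrAC.
- exact: uniq_trees.
- by move=> t; exact: (hT.1 [set t]).
- by move=> t t' _ _ [w [/= <- <-]].
- by move=> t tn; exact: (prob_conditioned_bienayme hxi hT tn).
- by rewrite -mulr_suml mulfV// gt_eqF.
- exact: discrete_measurable_comp hT.1.
- by move=> w /=.
- by move=> t _ w /set_mem /= ->.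
Qed.

Lemma expectation_node (g : seq nat -> R) : (forall u, 0 <= g u) ->
  ('E_P[g \o V] = ((\sum_(t <- trees n) weight (pmf mu) t *
     \sum_(u <- nodes t) g u) / (n%:R * Z))%:E)%E.
Proof.
move=> g0.
have n0 : n%:R != 0 :> R.
  apply/eqP => n0; have := convpow_size_weight (pmf mu) (n := n).
  move: wn; rewrite /size_weight.
  have -> : n = 0%N by apply/eqP; rewrite -(eqr_nat R) n0.
  by rewrite big_nil ltxx.
pose s := [seq (t, u) | t <- trees n, u <- nodes t].
pose b (tu : plane_tree * seq nat) := weight (pmf mu) tu.1 / Z * n%:R^-1.
have sum_s (x : plane_tree * seq nat -> R) :
    \sum_(tu <- s) x tu = \sum_(t <- trees n) \sum_(u <- nodes t) x (t, u).
  by rewrite big_allpairs_dep.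
rewrite (@expectation_partition _ _ _ P _ s
  (fun tu => [set w | T w = tu.1 /\ V w = tu.2]) b (g \o snd)).
- rewrite sum_s mulr_suml; congr (_%:E); apply: eq_bigr => t _.
  by rewrite /b/= -mulr_sumr invfM; ring.
- apply: allpairs_uniq_dep; first exact: uniq_trees.
    by move=> t _; exact: uniq_nodes.
  by move=> [t u] [t' u'] _ _ /= [-> ->].
- move=> tu; apply: measurableI; first exact: (hT.1 [set tu.1]).
  exact: (hV.1 [set tu.2]).
- by move=> [t u] [t' u'] _ _ [w [/= [<- <-] [<- <-]]].
- move=> [t u] /allpairsPdep[t' [u' [tn ut [-> ->]]]].
  rewrite hV.2//=; last by apply/eqP; rewrite -mem_trees.
  by rewrite (prob_conditioned_bienayme hxi hT tn) -EFinM.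
- rewrite sum_s big_seq (eq_bigr (fun t => weight (pmf mu) t / Z)) => [|t].
    by rewrite -big_seq -mulr_suml mulfV// gt_eqF.
  rewrite mem_trees => /eqP tn; rewrite /b/= big_const_seq count_predT.
  by rewrite iter_addr_0 -[size _]/(tree_size t) tn -[LHS]mulr_natr mulfVK.
- exact: discrete_measurable_comp hV.1.
- by move=> w /=.
- by move=> [t u] _ w /set_mem /= [_ ->].
Qed.

End ConditionedTree.

Theorem theorem1p2 (R : realType) (mu : probability nat R)
    (hmu1 : (pnorm mu 1 <= 1)%E) (hmu2 : pnorm mu 2 = +oo%E)
    (d0 : measure_display) (Omega0 : measurableType d0)
    (P0 : probability Omega0 R) (xi : seq nat -> {RV P0 >-> nat})
    (hxi : branching_process xi mu)
    (d : nat -> measure_display) (Omega : forall n, measurableType (d n))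
    (P : forall n, probability (Omega n) R)
    (T : forall n, Omega n -> plane_tree) (V : forall n, Omega n -> seq nat)
    (hT : forall n, (0 < P0 (bienayme_has_size xi n))%E ->
       conditioned_bienayme xi n (P n) (@T n))
    (hV : forall n, (0 < P0 (bienayme_has_size xi n))%E ->
       uniform_node n (P n) (@T n) (@V n)) :
  let F := within [set n | (0 < P0 (bienayme_has_size xi n))%E] \oo in
  let W := fun n (w : Omega n) => (wid (T n w))%:R / Num.sqrt n%:R : R in
  let D := fun n (w : Omega n) => (size (V n w))%:R / Num.sqrt n%:R : R in
  let H := fun n (w : Omega n) =>
    (ht (T n w))%:R / (Num.sqrt n%:R * ln n%:R ^+ 3) : R in
  [/\ to_oo_in_probability P F W /\ to_oo_in_expectation P F W,
      to0_in_probability P F D /\ to0_in_expectation P F D &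
      to0_in_probability P F H /\ to0_in_expectation P F H].
Proof.
move=> F W D H; set Q := pmf mu.
have p0 := @pmf_ge0 _ mu; have p1 := @pmf_mass_le1 _ mu.
have p2 := @pmf_mass1 _ mu; have p3 := pmf_mean_le1 hmu1.
have p4 := pmf_var_oo hmu2.
have eventually (S : nat -> Prop) n0 : (forall n, (n0 <= n)%N -> (0 < n)%N ->
    0 < size_weight Q n -> conditioned_bienayme xi n (P n) (T n) ->
    uniform_node n (P n) (T n) (V n) -> S n) -> \forall n \near F, S n.
  move=> h; exists n0 => // n /= n0n np.
  have wn : 0 < size_weight Q n.
    by move: np; rewrite (prob_bienayme_has_size hxi) lte_fin.
  apply: h => //; [|exact: hT|exact: hV].
  by rewrite lt0n; apply/eqP => nE; move: wn; rewrite nE /size_weight big_nil ltxx.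
have to0 (X : forall n, Omega n -> R) :
    (forall e, 0 < e -> \forall n \near F, [/\ measurable_fun setT (X n),
       (forall w, 0 <= X n w) & ('E_(P n)[X n] <= e%:E)%E]) ->
    to0_in_probability P F X /\ to0_in_expectation P F X.
  move=> h; split=> [a a0|]; apply: cvge_fin_le => e e0.
    apply: filterS (h (a * e) (mulr_gt0 a0 e0)) => n [mX X0 EX].
    have mA : measurable [set w | a < `|X n w|].
      rewrite (_ : mkset _ = X n @^-1` `]a, +oo[).
        by rewrite -[X in measurable X]setTI; exact: mX.
      by apply/seteqP; split => w /=; rewrite in_itv/= andbT ger0_norm.
    rewrite sub0r add0r (le_trans _ (measure_ge0 _ _))/=; last first.
      by rewrite lee_fin oppr_le0 ltW.
    rewrite -(@lee_pmul2l _ a%:E) ?lte_fin//.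
    rewrite -EFinM; apply: le_trans EX; apply: expectation_ge_prob => //.
      exact: ltW.
    by move=> w /=; rewrite ger0_norm// => /ltW.
  apply: filterS (h e e0) => n [mX X0 EX].
  rewrite sub0r add0r EX andbT (@le_trans _ _ 0%E) ?lee_fin ?oppr_le0 ?(ltW e0)//.
  exact: expectation_ge0.
have sqrt_gt0 n : (0 < n)%N -> 0 < Num.sqrt n%:R :> R.
  by move=> n0; rewrite sqrtr_gt0 ltr0n.
have Wprob (K e : R) : 0 < e -> \forall n \near F,
    measurable [set w | K <= W n w] /\
    ((1 - e)%:E <= P n [set w | (K <= W n w)%R])%E.
  move=> e0.
  have [n0 n0P] := sum_narrow_small p0 p1 p2 p3 p4 K e0.
  apply: (eventually _ n0) => n n0n n_gt0 wn cT _.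
  pose A := [set t | (wid t)%:R < K * Num.sqrt n%:R].
  have mA : measurable (T n @^-1` A) by exact: cT.1.
  have -> : [set w | K <= W n w] = ~` (T n @^-1` A).
    apply/seteqP; split => w /=; rewrite /A/= /W ler_pdivlMr ?sqrt_gt0// leNgt.
      by move/negP.
    by move/negP.
  split; first exact: measurableC.
  rewrite probability_setC// EFinB leeB// -expectation_indic//.
  rewrite (_ : \1_(T n @^-1` A) = (fun t => \1_A t) \o T n)//.
  rewrite (expectation_tree hxi cT wn)//.
  rewrite lee_fin ler_pdivrMr//; apply: le_trans (n0P n n0n wn).
  rewrite [leRHS]big_mkcond; apply: ler_sum => t _; rewrite indicE.
  have [|/negP] := boolP (t \in A).
    by rewrite in_setE /A/= => ->; rewrite mulr1.
  by rewrite in_setE /A/= => /negP/negPf ->; rewrite mulr0.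
split.
- split=> [K|].
    apply: cvge_fin_le => e e0; apply: filterS (Wprob K e e0) => n [mK ->]/=.
    by rewrite (le_trans (probability_le1 _ mK))// lee_fin lerDl ltW.
  apply/cvgeyPge => A; pose K := Num.max 0 (2 * A).
  have K0 : 0 <= K by rewrite le_max lexx.
  have KA : A <= K / 2 by rewrite ler_pdivlMr// mulrC le_max lexx orbT.
  have h12 : 0 < 2^-1 :> R by rewrite invr_gt0.
  apply: filterS2 (Wprob K _ h12) (eventually _ 0%N _) => [n|]; last first.
    by move=> n _ n_gt0 wn cT _; exact: (conj n_gt0 cT).
  move=> [mK PK] [n_gt0 cT].
  have mW : measurable_fun setT (W n).
    exact: (discrete_measurable_comp (fun t => (wid t)%:R / Num.sqrt n%:R) cT.1).
  apply: (@le_trans _ _ (K%:E * P n [set w | (K <= W n w)%R])%E).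
    apply: (@le_trans _ _ (K%:E * (1 - 2^-1)%:E)%E).
      by rewrite -EFinM lee_fin; lra.
    by rewrite lee_wpmul2l// lee_fin.
  by apply: expectation_ge_prob => // w; rewrite divr_ge0.
- apply: to0 => e e0.
  have [n0 n0P] := sum_depth_small p0 p1 p2 p3 p4 e0.
  apply: (eventually _ n0) => n n0n n_gt0 wn cT cV; split.
  + exact: (discrete_measurable_comp (fun v => (size v)%:R / Num.sqrt n%:R) cV.1).
  + by move=> w; rewrite divr_ge0.
  have g0 (u : seq nat) : 0 <= (size u)%:R / Num.sqrt n%:R :> R by rewrite divr_ge0.
  have -> : D n = (fun v => (size v)%:R / Num.sqrt n%:R) \o V n by [].
  rewrite (expectation_node hxi cT cV wn g0) lee_fin.
  rewrite ler_pdivrMr ?mulr_gt0 ?ltr0n//.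
  have s0 := sqrt_gt0 n n_gt0.
  rewrite -(ler_pM2l s0) mulr_sumr; apply: le_trans (le_trans _ (n0P n n0n wn)) _.
    rewrite le_eqVlt; apply/orP; left; apply/eqP; apply: eq_bigr => t _.
    by rewrite -mulr_suml /depth_sum natr_sum mulrCA [_ / _]mulrC mulVKf// gt_eqF.
  by rewrite le_eqVlt; apply/orP; left; apply/eqP; ring.
apply: to0 => e e0.
have [n0 n0P] := sum_ht_small p0 p1 p2 p3 p4 e0.
have [n1 n1P] := @ln_large R 1.
apply: (eventually _ (maxn n0 n1)) => n; rewrite geq_max => /andP[n0n /n1P ln1].
move=> n_gt0 wn cT _.
have ln0 : 0 < ln n%:R :> R by apply: lt_le_trans ln1.
have c0 : 0 < Num.sqrt n%:R * ln n%:R ^+ 3 :> R.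
  by rewrite mulr_gt0 ?sqrt_gt0 ?exprn_gt0.
split.
+ exact: (discrete_measurable_comp
    (fun t => (ht t)%:R / (Num.sqrt n%:R * ln n%:R ^+ 3)) cT.1).
+ by move=> w; rewrite divr_ge0// ltW.
have g0 t : 0 <= (ht t)%:R / (Num.sqrt n%:R * ln n%:R ^+ 3) :> R.
  by rewrite divr_ge0// ltW.
have -> : H n = (fun t => (ht t)%:R / (Num.sqrt n%:R * ln n%:R ^+ 3)) \o T n by [].
rewrite (expectation_tree hxi cT wn g0) lee_fin ler_pdivrMr//.
under eq_bigr do rewrite mulrA.
rewrite -mulr_suml ler_pdivrMr// mulrAC; exact: n0P.
Qed.
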